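(* Let $E$ and $F$ be two atomic JBW$^*$-triples. Suppose $\Delta:E\to F$ is a (not necessarily linear) bijection preserving the truncation of triple products in both directions. Assume additionally that $\Delta(\alpha e)=\alpha\Delta(e)$ for every minimal tripotent $e\in E$ and all $\alpha\in\mathbb{C}$. Let $T:E\to F$ be a triple isomorphism satisfying $T(e)=\Delta(e)$ for every minimal tripotent $e\in E$. Then $\Delta=T$ is a linear triple isomorphism. If we assume that $\Delta(\alpha e)=\overline{\alpha}\Delta(e)$ for every minimal tripotent $e\in E$ and all $\alpha\in\mathbb{C}$, then $\Delta$ is a conjugate-linear triple isomorphism.
   Context: A JB$^*$-triple is a complex Banach space $E$ with a continuous triple product $\{\cdot,\cdot,\cdot\}:E^3\to E$, symmetric and linear in the outer variables, conjugate-linear in the middle one, such that, with $L(a,b)(c)=\{a,b,c\}$: (i) $L(w,v)\{x,y,z\}=\{L(w,v)x,y,z\}-\{x,L(v,w)y,z\}+\{x,y,L(w,v)z\}$; (ii) $L(x,x)$ is hermitian with non-negative spectrum; (iii) $\|\{x,x,x\}\|=\|x\|^3$. A JBW$^*$-triple is a JB$^*$-triple which is a dual Banach space. A tripotent is an element $e$ with $\{e,e,e\}=e$; it is minimal if $E_2(e):=\{a\in E: L(e,e)(a)=a\}=\mathbb{C}e\neq\{0\}$. A JBW$^*$-triple is atomic if the linear span of its minimal tripotents is weak$^*$-dense. A triple isomorphism is a linear bijection preserving triple products; a conjugate-linear triple isomorphism is a conjugate-linear bijection preserving triple products. For $a,b$ in a JB$^*$-triple, $a$ is a truncation of $b$ if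 $\{a,a,a\}=\{a,b,a\}$. A bijection $\Delta:E\to F$ preserves the truncation of triple products in both directions if for all $a,b,c\in E$: $a$ is a truncation of $\{b,c,b\}$ if and only if $\Delta(a)$ is a truncation of $\{\Delta(b),\Delta(c),\Delta(b)\}$. *)

(* Defs.v *)
From HB Require Import structures.
From mathcomp Require Import all_boot all_order all_algebra.
From mathcomp Require Import all_classical all_reals all_analysis.
From mathcomp Require Import complex.

Set Implicit Arguments.
Unset Strict Implicit.
Unset Printing Implicit Defensive.

Import Order.TTheory GRing.Theory Num.Theory.
Import numFieldNormedType.Exports.

Local Open Scope classical_set_scope.
Local Open Scope ring_scope.

Definition conj_linear (R : realType) (U V : lmodType R[i]) (f : U -> V) : Prop :=
  linear_for (fun (a : R[i]) (v : V) => Num.conj a *: v) f.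

Section operators.
Variables (R : realType) (E : completeNormedModType R[i]).

(* For a bounded operator A the series converges absolutely, so that [limn]
   is its sum. *)
Definition op_exp (A : E -> E) (x : E) : E :=
  limn (series (fun n : nat => (n`!%:R : R[i])^-1 *: iter n A x)).

(* A bounded operator A on a complex Banach space is hermitian when
   exp(itA) is isometric for all real t. *)
Definition hermitian_op (A : E -> E) : Prop :=
  forall (t : R) (x : E),
    `|op_exp (fun y => (0 +i* t)%C *: A y) x| = `|x|.

(* Spectrum in the Banach algebra of bounded operators; the inverse of a
   linear map is automatically linear. *)
Definition op_spectrum (A : E -> E) : set R[i] :=
  [set l : R[i] | ~ exists S : E -> E,
     [/\ continuous S, cancel (fun x => A x - l *: x) S
       & cancel S (fun x => A x - l *: x)]].

End operators.

(* The order of R[i] satisfies 0 <= l iff l is a nonnegative real number;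
   the norm of E is valued in R[i]. *)
Record is_JBstar_triple (R : realType) (E : completeNormedModType R[i])
    (tp : E -> E -> E -> E) : Prop := IsJBstarTriple {
  tp_continuous : continuous (fun p : E * E * E => tp p.1.1 p.1.2 p.2) ;
  tp_sym : forall x y z, tp x y z = tp z y x ;
  tp_linear : forall y z, linear (fun x => tp x y z) ;
  tp_conj_linear : forall x z, conj_linear (fun y => tp x y z) ;
  tp_jordan : forall w v x y z,
    tp w v (tp x y z) =
      tp (tp w v x) y z - tp x (tp v w y) z + tp x y (tp w v z) ;
  tp_hermitian : forall x, hermitian_op (tp x x) ;
  tp_spectrum : forall x (l : R[i]), op_spectrum (tp x x) l -> 0 <= l ;
  tp_norm : forall x, `|tp x x x| = `|x| ^+ 3
}.

Record jbTriple (R : realType) := JBTriple {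
  jb_space :> completeNormedModType R[i] ;
  triple : jb_space -> jb_space -> jb_space -> jb_space ;
  jb_axioms : is_JBstar_triple triple
}.

(* [pair] identifies E isometrically with the dual of P: the least c with
   |<x, p>| <= c |p| for all p is the norm of the functional <x, _>. *)
Record is_dual_pairing (R : realType) (E P : completeNormedModType R[i])
    (pair : E -> P -> R[i]^o) : Prop := IsDualPairing {
  pair_linearl : forall p, linear (fun x => pair x p) ;
  pair_linearr : forall x, linear (pair x) ;
  pair_continuous : forall x, continuous (pair x) ;
  pair_norm : forall x (c : R[i]), 0 <= c ->
    (`|x| <= c <-> forall p, `|pair x p| <= c * `|p|) ;
  pair_surj : forall phi : P -> R[i]^o, linear phi -> continuous phi ->
    exists x, forall p, pair x p = phi p
}.

Record jbwTriple (R : realType) := JBWTriple {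
  jbw_jb :> jbTriple R ;
  predual : completeNormedModType R[i] ;
  predual_pairing : jbw_jb -> predual -> R[i]^o ;
  jbw_axioms : is_dual_pairing predual_pairing
}.

Section triples.
Variables (R : realType) (E : jbTriple R).

Definition tripotent (e : E) : Prop := triple e e e = e.

Definition peirce2 (e : E) : set E := [set a | triple e e a = a].

Definition minimal_tripotent (e : E) : Prop :=
  [/\ tripotent e, peirce2 e = [set a *: e | a in [set: R[i]]]
    & peirce2 e <> [set 0]].

Definition truncation (a b : E) : Prop := triple a a a = triple a b a.

End triples.

Definition linear_span (K : nzRingType) (V : lmodType K) (A : set V) : set V :=
  [set x | exists (n : nat) (a : 'I_n -> K) (v : 'I_n -> V),
     (forall i, A (v i)) /\ x = \sum_(i < n) a i *: v i].

Definition weak_star (R : realType) (E : jbwTriple R) : topologicalType :=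
  initial_topology (@predual_pairing R E : E -> {ptws predual E -> R[i]^o}).

Definition atomic (R : realType) (E : jbwTriple R) : Prop :=
  dense (linear_span (@minimal_tripotent R E) : set (weak_star E)).

Definition triple_isomorphism (R : realType) (E F : jbTriple R)
    (T : E -> F) : Prop :=
  [/\ linear T, bijective T
    & forall x y z, T (triple x y z) = triple (T x) (T y) (T z)].

Definition conj_triple_isomorphism (R : realType) (E F : jbTriple R)
    (T : E -> F) : Prop :=
  [/\ conj_linear T, bijective T
    & forall x y z, T (triple x y z) = triple (T x) (T y) (T z)].

Definition preserves_truncation (R : realType) (E F : jbTriple R)
    (D : E -> F) : Prop :=
  forall a b c : E,
    truncation a (triple b c b) <-> truncation (D a) (triple (D b) (D c) (D b)).

(* Main.v *)
(* Write [Q(e) x = {e, x, e}]. If [e] is a minimal tripotent, [Q(e) x = l e] for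
   a scalar [l], and a non-zero multiple [a e] is a truncation of [x] exactly
   when the conjugate of [a] is [l]. Truncations of triple products therefore
   determine these scalars for [x = {b, c, b}], and also for [x = c] by taking
   [b = e]; moreover Delta maps minimal tripotents to minimal tripotents. Hence
   Delta is (conjugate-)linear and multiplicative as soon as the scalars attached
   to the minimal tripotents determine [x]: if [Q(e) x = 0] for every minimal
   tripotent [e], then [x = 0].

   This non-degeneracy is the analytic core. Let [N] be the set of the [x] with
   [Q(e) x = 0] for all minimal [e]. Moving [e] by the structure group shows that
   the elements of [N] are orthogonal to the minimal tripotents. Each functional
   [x |-> l] above is normal, because norming a tripotent almost kills its
   Peirce-1 and Peirce-0 spaces. So [N] is a dual space, and its unit ball
   contains an extreme point [y] attaining the norm of a given normal functional
   modulo the annihilator of [N]. By functional calculus [y] is the midpoint of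
   the images of [y] under [2 t / (1 + t^2)] and [2 t^3 / (1 + t^2)], whence [y]
   is a tripotent. One obtains a non-zero normal functional supported by the
   Peirce-2 space of [y], and it vanishes on all minimal tripotents,
   contradicting the atomicity. *)
Require Import Defs.
From HB Require Import structures.
From mathcomp Require Import all_boot all_order all_algebra.
From mathcomp Require Import all_classical all_reals all_analysis.
From mathcomp Require Import complex ring lra.

Set Implicit Arguments.
Unset Strict Implicit.
Unset Printing Implicit Defensive.

Import Order.TTheory GRing.Theory Num.Theory.
Import numFieldNormedType.Exports.

Local Open Scope classical_set_scope.
Local Open Scope ring_scope.

(** The argument works from the axioms: it goes through neither a Gelfand representation of the
    subtriple generated by an element nor weak-star continuity of the triple product. Three devices
    stand in for them. Orthogonality: [Q(u) x = 0] says nothing about the Peirce-1 part [b] of [x].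
    Exponentials of [b] and of [- b] give two equations whose difference isolates [{u, b, b}], and
    positivity of [L(b,b)] does the rest. Functional calculus: both functions come from [x] by
    rational functions of [L(x,x)] with a single pole at -1, where positivity of the spectrum
    provides a resolvent. Their norms are bounded by iterating [|{a, a, a}| = |a|^3]: a norm above 1
    would make odd powers of [a] grow geometrically, against the spectral radius of
    [4 L (1 + L)^-2], which is at most 1. Normality: atomicity only controls functionals in the
    predual, so the supported functional is built there as a norm limit. This works because
    [|e + z|] exceeds 1 by at most a multiple of [|z|^2] on the kernel of [Q(e)]: there is no
    first-order term. *)

(** * Linear identities in modules *)

Inductive lexp (K : Type) : Type :=
| LVar of nat | LZero | LAdd of lexp K & lexp K | LOpp of lexp K
| LScale of K & lexp K | LMuln of lexp K & nat.
Arguments LVar {K}.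
Arguments LZero {K}.

Section linear_expressions.
Variables (K : comNzRingType) (V : lmodType K).
Implicit Types (e : lexp K) (env : seq V).

Fixpoint leval env e : V :=
  match e with
  | LVar n => nth 0 env n
  | LZero => 0
  | LAdd e1 e2 => leval env e1 + leval env e2
  | LOpp e1 => - leval env e1
  | LScale k e1 => k *: leval env e1
  | LMuln e1 n => leval env e1 *+ n
  end.

(** The test is [eqn] rather than [==] so that [cbn] decides it on numerals and leaves a scalar
    identity for [ring] or [field]. *)
Fixpoint lcoef e (i : nat) : K :=
  match e with
  | LVar n => if eqn n i then 1 else 0
  | LZero => 0
  | LAdd e1 e2 => lcoef e1 i + lcoef e2 i
  | LOpp e1 => - lcoef e1 i
  | LScale k e1 => k * lcoef e1 i
  | LMuln e1 n => lcoef e1 i *+ n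
  end.

Lemma leval_sum env e :
  leval env e = \sum_(i < size env) lcoef e i *: nth 0 env i.
Proof.
elim: e => [n| |e1 IH1 e2 IH2|e1 IH1|k e1 IH1|e1 IH1 n] /=.
- case: (ltnP n (size env)) => hn.
    rewrite (bigD1 (Ordinal hn)) //= -[eqn _ _]/(n == n) eqxx scale1r.
    rewrite big1 ?addr0 // => i.
    rewrite -val_eqE /= eq_sym -[eqn _ _]/(n == i :> nat) => /negPf ->.
    by rewrite scale0r.
  rewrite nth_default // big1 // => i _; rewrite -[eqn _ _]/(n == i :> nat).
  by rewrite gtn_eqF ?scale0r // (leq_trans (ltn_ord i)).
- by rewrite big1 // => i _; rewrite scale0r.
- by rewrite IH1 IH2 -big_split; apply: eq_bigr => i _; rewrite scalerDl.
- by rewrite IH1 -sumrN; apply: eq_bigr => i _; rewrite scaleNr.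
- by rewrite IH1 scaler_sumr; apply: eq_bigr => i _; rewrite scalerA.
- by rewrite IH1 -sumrMnl; apply: eq_bigr => i _; rewrite scalerMnl.
Qed.

Fixpoint lcoefs_eq e1 e2 (n : nat) : Prop :=
  if n is n'.+1 then lcoef e1 n' = lcoef e2 n' /\ lcoefs_eq e1 e2 n' else True.

Lemma leval_eq env e1 e2 :
  lcoefs_eq e1 e2 (size env) -> leval env e1 = leval env e2.
Proof.
move=> h; rewrite !leval_sum; apply: eq_bigr => i _; congr (_ *: _).
elim: (size env) h i => [_ []//|n IH [h1 h2] i].
case: (ltngtP i n) => [lin|nli|->//]; first exact: (IH h2 (Ordinal lin)).
by move: (ltn_ord i); rewrite ltnS leqNgt nli.
Qed.

(** A certificate: the goal becomes a formal identity expressing the difference of its sides as [k]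
    times that of a known equation. The scalars at the call sites come from eliminating terms among
    Jordan identities. *)
Lemma eq_lincomb1 (k : K) (l r a b : V) :
  l = r -> a - b = k *: (l - r) -> a = b.
Proof.
by move=> -> h; apply/eqP; rewrite -subr_eq0 h subrr scaler0.
Qed.

Lemma eq_lincomb2 (k1 k2 : K) (l1 r1 l2 r2 a b : V) : l1 = r1 -> l2 = r2 ->
  a - b = k1 *: (l1 - r1) + k2 *: (l2 - r2) -> a = b.
Proof.
by move=> -> -> h; apply/eqP; rewrite -subr_eq0 h !subrr !scaler0 addr0.
Qed.

End linear_expressions.

Ltac lmem x l :=
  lazymatch l with
  | nil => constr:(false)
  | x :: _ => constr:(true)
  | _ :: ?l' => lmem x l'
  end.
Ltac lindex x l :=
  lazymatch l with
  | x :: _ => constr:(0%N)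
  | _ :: ?l' => let n := lindex x l' in constr:(n.+1)
  end.
Ltac latoms t l :=
  lazymatch t with
  | @GRing.add _ ?a ?b => let l1 := latoms a l in latoms b l1
  | @GRing.opp _ ?a => latoms a l
  | @GRing.scale _ _ _ ?a => latoms a l
  | @GRing.natmul _ ?a _ => latoms a l
  | @GRing.zero _ => l
  | _ => lazymatch lmem t l with true => l | false => constr:(t :: l) end
  end.
Ltac lreify K t l :=
  lazymatch t with
  | @GRing.add _ ?a ?b =>
    let e1 := lreify K a l in let e2 := lreify K b l in
    constr:(@LAdd K e1 e2)
  | @GRing.opp _ ?a => let e1 := lreify K a l in constr:(@LOpp K e1)
  | @GRing.scale _ _ ?k ?a =>
    let e1 := lreify K a l in constr:(@LScale K k e1)
  | @GRing.natmul _ ?a ?n => let e1 := lreify K a l in constr:(@LMuln K e1 n)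
  | @GRing.zero _ => constr:(@LZero K)
  | _ => let n := lindex t l in constr:(@LVar K n)
  end.

(* Proves identities between linear combinations in a module whose scalars
   are complex numbers by comparing coefficients. *)
Ltac lmod_in K V :=
  lazymatch goal with |- @eq ?T ?a ?b =>
    let l := latoms a (@nil T) in
    let l := latoms b l in
    let e1 := lreify K a l in
    let e2 := lreify K b l in
    change (@leval _ V l e1 = @leval _ V l e2);
    apply: leval_eq;
    cbn [lcoefs_eq lcoef size eqn];
    repeat (split;
      [solve [ring | field | field; rewrite ?pnatr_eq0 ?oner_eq0 //] | ]);
    exact: I
  end.

(** * Algebra of Jordan triples *)

Notation "<| x , y , z |>" := (triple x y z)
  (at level 0, x, y, z at level 60, format "<| x ,  y ,  z |>").

Section triple_algebra.
Variables (R : realType) (E : jbTriple R).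
Implicit Types (x y z a b c e u v w : E) (k : R[i]).

Local Ltac lmod := lmod_in R[i] E.

Lemma tpC x y z : <|x, y, z|> = <|z, y, x|>.
Proof. exact: (tp_sym (jb_axioms E)). Qed.

Lemma tpDl x x' y z : <|x + x', y, z|> = <|x, y, z|> + <|x', y, z|>.
Proof.
by have := tp_linear (jb_axioms E) y z 1 x x'; rewrite /= !scale1r.
Qed.

Lemma tpDm x y y' z : <|x, y + y', z|> = <|x, y, z|> + <|x, y', z|>.
Proof.
have := tp_conj_linear (jb_axioms E) x z 1 y y'.
by rewrite /= scale1r rmorph1 scale1r.
Qed.

Lemma tpDr x y z z' : <|x, y, z + z'|> = <|x, y, z|> + <|x, y, z'|>.
Proof. by rewrite tpC tpDl (tpC z) (tpC z'). Qed.

Lemma tp0l y z : <|0, y, z|> = 0.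
Proof. by apply: (@addrI _ <|0, y, z|>); rewrite -tpDl !addr0. Qed.

Lemma tp0m x z : <|x, 0, z|> = 0.
Proof. by apply: (@addrI _ <|x, 0, z|>); rewrite -tpDm !addr0. Qed.

Lemma tp0r x y : <|x, y, 0|> = 0.
Proof. by rewrite tpC tp0l. Qed.

Lemma tpZl k x y z : <|k *: x, y, z|> = k *: <|x, y, z|>.
Proof.
by have := tp_linear (jb_axioms E) y z k x 0; rewrite /= tp0l !addr0.
Qed.

Lemma tpZm k x y z : <|x, k *: y, z|> = Num.conj k *: <|x, y, z|>.
Proof.
by have := tp_conj_linear (jb_axioms E) x z k y 0; rewrite /= tp0m !addr0.
Qed.

Lemma tpZr k x y z : <|x, y, k *: z|> = k *: <|x, y, z|>.
Proof. by rewrite tpC tpZl tpC. Qed.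

Lemma tpNl x y z : <|- x, y, z|> = - <|x, y, z|>.
Proof. by rewrite -scaleN1r tpZl scaleN1r. Qed.

Lemma tpNm x y z : <|x, - y, z|> = - <|x, y, z|>.
Proof. by rewrite -scaleN1r tpZm rmorphN1 scaleN1r. Qed.

Lemma tpNr x y z : <|x, y, - z|> = - <|x, y, z|>.
Proof. by rewrite tpC tpNl tpC. Qed.

Definition tpD := (tpDl, tpDm, tpDr).
Definition tpN := (tpNl, tpNm, tpNr).
Definition tp0 := (tp0l, tp0m, tp0r).

Lemma tp_jordanE w v x y z : <|w, v, <|x, y, z|>|> =
  <| <|w, v, x|>, y, z|> - <|x, <|v, w, y|>, z|> + <|x, y, <|w, v, z|>|>.
Proof. exact: (tp_jordan (jb_axioms E)). Qed.

Lemma tp_cube_eq0 x : <|x, x, x|> = 0 -> x = 0.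
Proof.
move=> x3; apply/eqP; rewrite -normr_eq0.
have := tp_norm (jb_axioms E) x; rewrite x3 normr0 => /esym/eqP.
by rewrite expf_eq0.
Qed.

(** Expanding [<|x, y, <|x, z, x|>|>] and [<|x, z, <|x, y, x|>|>] by the Jordan identity gives two
    linear equations; eliminating the second product leaves the claim. *)
Lemma tp_JP1 x y z : <|x, y, <|x, z, x|>|> = <|x, <|y, x, z|>, x|>.
Proof.
have h1 := tp_jordanE x y x z x.
have h2 := tp_jordanE x z x y x.
rewrite (tpC <|x, y, x|> z x) in h1; rewrite (tpC <|x, z, x|> y x) in h2.
rewrite (tpC z x y) in h2.
apply: (@eq_lincomb2 _ _ (- 3%:R^-1) (- (2%:R / 3%:R)) _ _ _ _ _ _ h1 h2).
lmod.
Qed.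

(** All eight triple products with entries among [a] and [c = {a, a, a}] equal [c]. Hence the cube
    of [c - a] is [(1 - 1)^3 c = 0], and only 0 has cube 0. *)
Lemma tripotent_trunc a : truncation a <|a, a, a|> <-> tripotent a.
Proof.
rewrite /truncation /tripotent; split=> [|a3]; last by rewrite !a3.
set c := <|a, a, a|> => aca; apply/eqP; rewrite -subr_eq0; apply/eqP.
apply: tp_cube_eq0.
have aac : <|a, a, c|> = c by rewrite tp_JP1 -/c -aca.
have caa : <|c, a, a|> = c by rewrite tpC.
have cca : <|c, c, a|> = c.
  have := tp_jordanE a a a c a; rewrite -aca aac -[<|a, a, a|>]/c -aca.
  rewrite (tpC a c c) => h.
  by apply: (@eq_lincomb1 _ _ (- 2%:R^-1) _ _ _ _ h); lmod.
have acc : <|a, c, c|> = c by rewrite tpC.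
have cac : <|c, a, c|> = c.
  have := tp_jordanE a a a a c; rewrite aac -[<|a, a, a|>]/c acc aac => h.
  by apply: (@eq_lincomb1 _ _ (-1) _ _ _ _ h); lmod.
have ccc : <|c, c, c|> = c.
  have := tp_jordanE a a a c c; rewrite acc aac -[<|a, a, a|>]/c acc => h.
  by apply: (@eq_lincomb1 _ _ (-1) _ _ _ _ h); lmod.
rewrite !(tpD, tpN) ccc cca cac caa acc aac -aca -[<|a, a, a|>]/c; lmod.
Qed.

(** * Peirce calculus of a tripotent *)

Section tripotents.
Variable e : E.
Hypothesis e3 : tripotent e.
Local Notation L := (fun x => <|e, e, x|>).
Local Notation Q := (fun x => <|e, x, e|>).

Lemma tripotent_LQ x : <|e, e, <|e, x, e|>|> = <|e, x, e|>.
Proof.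
have h1 := tp_jordanE e e e x e; have h2 := tp_jordanE e x e e e.
rewrite !e3 in h1 h2; rewrite (tpC x e e) (tpC <|e, x, e|>) in h2.
apply: (@eq_lincomb2 _ _ (3%:R^-1) (- 3%:R^-1) _ _ _ _ _ _ h1 h2).
lmod.
Qed.

Lemma tripotent_QL x : <|e, <|e, e, x|>, e|> = <|e, x, e|>.
Proof.
have h1 := tp_jordanE e e e x e; rewrite !e3 tripotent_LQ in h1.
by apply: (@eq_lincomb1 _ _ 1 _ _ _ _ h1); lmod.
Qed.

Lemma tripotent_QQ x :
  <|e, <|e, x, e|>, e|> = <|e, e, <|e, e, x|>|> *+ 2 - <|e, e, x|>.
Proof.
have h := tp_jordanE x e e e e; rewrite !e3 (tpC x e e) in h.
rewrite (tpC <|e, e, x|> e e) in h.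
by apply: (@eq_lincomb1 _ _ 1 _ _ _ _ h); lmod.
Qed.

Lemma tripotent_QQQ x : <|e, <|e, <|e, x, e|>, e|>, e|> = <|e, x, e|>.
Proof. by rewrite (tripotent_QQ <|e, x, e|>) !tripotent_LQ; lmod. Qed.

(** Putting [L x] for [x] in [Q^2 = 2 L^2 - L], where [Q L = Q]. This is [L (2 L - 1) (L - 1) = 0],
    the equation behind the Peirce decomposition. *)
Lemma tripotent_LLL x : <|e, e, <|e, e, <|e, e, x|>|>|> =
  (3%:R / 2%:R) *: <|e, e, <|e, e, x|>|> - 2%:R^-1 *: <|e, e, x|>.
Proof.
have h := tripotent_QQ <|e, e, x|>; rewrite tripotent_QL tripotent_QQ in h.
by apply: (@eq_lincomb1 _ _ (- 2%:R^-1) _ _ _ _ h); lmod.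
Qed.

Lemma peirce2_QQ x : <|e, e, x|> = x -> <|e, <|e, x, e|>, e|> = x.
Proof. by move=> ex; rewrite tripotent_QQ !ex; lmod. Qed.

Lemma peirce0_Q x : <|e, e, x|> = 0 -> <|e, x, e|> = 0.
Proof. by move=> ex; rewrite -tripotent_QL ex tp0. Qed.

(* The eigenvalues of L(e,e) are 0, 1/2 and 1. *)
Lemma peirce_eigen0 k x : <|e, e, x|> = k *: x ->
  k * (k *+ 2 - 1) * (k - 1) != 0 -> x = 0.
Proof.
move=> ex k0; have h := tripotent_LLL x; rewrite ex !(tpZr, ex) in h.
have : (k * (k *+ 2 - 1) * (k - 1)) *: x = 0.
  by apply: (@eq_lincomb1 _ _ (2%:R) _ _ _ _ h); lmod.
by move/eqP; rewrite scaler_eq0 (negPf k0) => /eqP.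
Qed.

(** The commutator of [L(e,e)] with [{e, y, _}] is that operator itself by one Jordan identity and 0
    by the other. *)
Lemma peirce0_Ll y z : <|e, e, y|> = 0 -> <|e, y, z|> = 0.
Proof.
move=> ey.
have h1 := tp_jordanE e e e y z; have h2 := tp_jordanE e y e e z.
rewrite e3 ey tp0 in h1; rewrite (tpC y e e) ey peirce0_Q // !tp0 in h2.
by apply: (@eq_lincomb2 _ _ (-1) (-1) _ _ _ _ _ _ h1 h2); lmod.
Qed.

Lemma peirce0_Lr y z : <|e, e, y|> = 0 -> <|y, e, z|> = 0.
Proof.
move=> ey.
have h1 := tp_jordanE e e y e z; have h2 := tp_jordanE y e e e z.
rewrite e3 ey tp0 in h1; rewrite (tpC y e e) ey peirce0_Q // !tp0 in h2.
by apply: (@eq_lincomb2 _ _ 1 1 _ _ _ _ _ _ h1 h2); lmod.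
Qed.

(** [L = L(e,e)] anticommutes with [Q(x)]. The cubic equation of [L], taken on both sides of [Q(x)],
    therefore appears with opposite odd terms; combining the two kills [Q(x) L^2], and then
    [Q(x) L]. *)
Lemma peirce0_QL x w : <|e, e, x|> = 0 -> <|x, <|e, e, w|>, x|> = 0.
Proof.
move=> ex.
have LQ v : <|e, e, <|x, v, x|>|> = - <|x, <|e, e, v|>, x|>.
  by rewrite tp_jordanE ex !tp0; lmod.
have k1 : Num.conj (3%:R / 2%:R : R[i]) = 3%:R / 2%:R.
  by rewrite fmorph_div !rmorph_nat.
have k2 : Num.conj (2%:R^-1 : R[i]) = 2%:R^-1 by rewrite fmorphV rmorph_nat.
have QLLL v := congr1 (fun v => <|x, v, x|>) (tripotent_LLL v).
have QLL v : <|x, <|e, e, <|e, e, v|>|>, x|> = 0.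
  have h1 := QLLL v; have h2 := tripotent_LLL <|x, v, x|>.
  rewrite /= !(LQ, tpD, tpN, tpZm, k1, k2, opprK) in h1 h2.
  by apply: (@eq_lincomb2 _ _ (- 3%:R^-1) (-3%:R^-1) _ _ _ _ _ _ h1 h2); lmod.
have h := QLLL w.
rewrite /= !(tpD, tpN, tpZm, k1, k2, QLL) in h.
by apply: (@eq_lincomb1 _ _ (2%:R) _ _ _ _ h); lmod.
Qed.

End tripotents.

End triple_algebra.

(** * Minimal tripotents and rank-one elements *)

Section rank_one_elements.
Variables (R : realType) (E : jbTriple R).
Implicit Types (x y z a b c e u v w : E) (k : R[i]).

Local Ltac lmod := lmod_in R[i] E.

Lemma spectrum_eigen x v k : <|x, x, v|> = k *: v -> v != 0 -> 0 <= k.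
Proof.
move=> xv v0; apply: (tp_spectrum (jb_axioms E) (x := x)) => -[S [_ SK _]].
have := SK v; have := SK 0; rewrite /= xv tp0r scaler0 !subrr => -> v0'.
by rewrite -v0' eqxx in v0.
Qed.

(** Minimality freed from the normalization [{v, v, v} = v], which the structure group does not
    preserve. *)
Definition rank_one v : Prop := forall y, exists k, <|v, y, v|> = k *: v.

Lemma minimal_neq0 e : minimal_tripotent e -> e != 0.
Proof.
move=> [_ e2 e20]; apply/eqP => e0; apply: e20; rewrite e2 e0.
by apply/seteqP; split=> [_ [k _ <-]|_ ->];
  [rewrite /= scaler0|exists 0; rewrite ?scaler0].
Qed.

Lemma minimal_rank_one e : minimal_tripotent e -> rank_one e.
Proof.
move=> [e3 e2 _] y; have : peirce2 e <|e, y, e|> by exact: tripotent_LQ.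
by rewrite e2 => -[k _ <-]; exists k.
Qed.

Lemma rank_one_minimal e :
  tripotent e -> e != 0 -> rank_one e -> minimal_tripotent e.
Proof.
move=> e3 e0 e1; split=> //.
  apply/seteqP; split=> [a ea|_ [k _ <-]].
    have [k kE] := e1 <|e, a, e|>; exists k => //.
    by rewrite -kE peirce2_QQ.
  by rewrite /peirce2 /= tpZr e3.
move=> e20; have : peirce2 e e by [].
by rewrite e20 => /eqP; rewrite (negPf e0).
Qed.

(** The eigenvalue [l] of [L(v,v)] at [v] is positive by the spectrum axiom, so dividing by its
    square root turns [v] into a tripotent. *)
Lemma rank_one_scale v : rank_one v -> v != 0 ->
  exists e k, minimal_tripotent e /\ v = k *: e.
Proof.
move=> v1 v0; have [l vl] := v1 v.
have l0 : l != 0.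
  apply: contra v0 => /eqP l0; apply/eqP/tp_cube_eq0.
  by rewrite vl l0 scale0r.
have lge0 : 0 <= l := spectrum_eigen vl v0.
pose s := sqrtC l.
have s0 : s != 0 by rewrite sqrtC_eq0.
have cs : Num.conj s^-1 = s^-1.
  by apply: conj_Creal; rewrite rpredV sqrtC_real.
have s2 : s ^+ 2 = l := sqrtCK l.
have Qe y k : <|v, y, v|> = k *: v ->
    <|s^-1 *: v, y, s^-1 *: v|> = (s^-1 * k) *: (s^-1 *: v).
  by move=> vy; rewrite tpZl tpZr vy !scalerA; congr (_ *: _); ring.
exists (s^-1 *: v), s; split; last by rewrite scalerA divff ?scale1r.
apply: rank_one_minimal.
- rewrite /tripotent tpZm cs (Qe _ _ vl) !scalerA -s2; congr (_ *: _).
  by field.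
- by rewrite scaler_eq0 invr_eq0 negb_or s0.
- by move=> y; have [k vy] := v1 y; exists (s^-1 * k); exact: Qe.
Qed.

Section minimal.
Variable u : E.
Hypothesis u_min : minimal_tripotent u.

Let u3 : tripotent u. Proof. by case: u_min. Qed.
Let u0 : u != 0. Proof. exact: minimal_neq0. Qed.

Let conjV2 : Num.conj (2%:R^-1 : R[i]) = 2%:R^-1.
Proof. by rewrite fmorphV rmorph_nat. Qed.

Let scale_u k k' : k *: u = k' *: u -> k = k'.
Proof.
move/eqP; rewrite -subr_eq0 -scalerBl scaler_eq0 (negPf u0) orbF subr_eq0.
by move/eqP.
Qed.

Let peirce2_u y : <|u, u, y|> = y -> exists k, y = k *: u.
Proof.
move=> uy; have [_ u2 _] := u_min; have : peirce2 u y by [].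
by rewrite u2 => -[k _ <-]; exists k.
Qed.

Lemma peirce_decomposition y : exists k y1 y0,
  [/\ y = k *: u + y1 + y0, <|u, u, y1|> = 2%:R^-1 *: y1, <|u, u, y0|> = 0
    & <|u, y, u|> = Num.conj k *: u].
Proof.
have [k ku] := minimal_rank_one u_min <|u, y, u|>.
(* [y1] and [y0] are the interpolation polynomials of [L(u,u)] that select the eigenvalues 1/2 and 0
   among 0, 1/2, 1. *)
pose y1 := 4%:R *: (<|u, u, y|> - <|u, u, <|u, u, y|>|>).
pose y0 := y - 3%:R *: <|u, u, y|> + 2%:R *: <|u, u, <|u, u, y|>|>.
have := tripotent_QQ u3 y; rewrite ku => kE.
exists k, y1, y0; split.
- by rewrite kE /y1 /y0; lmod.
- by rewrite /y1 tpZr !(tpD, tpN) tripotent_LLL //; lmod.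
- by rewrite /y0 !(tpD, tpN, tpZr) tripotent_LLL //; lmod.
- by rewrite -(tripotent_QQQ u3 y) ku tpZm u3.
Qed.

Section exponential.
Variable a : E.
Hypothesis ua : <|u, u, a|> = 2%:R^-1 *: a.
Let c := <|a, u, a|>.

Let uau : <|u, a, u|> = 0.
Proof.
have := tripotent_QL u3 a; rewrite ua tpZm conjV2 => h.
by apply: (@eq_lincomb1 _ _ (- 2%:R) _ _ _ _ h); lmod.
Qed.

Lemma peirce1_square : <|u, u, c|> = 0.
Proof. by rewrite /c tp_jordanE ua u3 tpZl tpZr; lmod. Qed.

(** The Peirce eigenvalue is 1 - 1/2 + 1/2 = 1, and by minimality that eigenspace is the line of
    [u]. *)
Lemma peirce1_form y : <|u, u, y|> = 2%:R^-1 *: y ->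
  exists k, <|u, y, a|> = k *: u.
Proof.
move=> uy; apply: peirce2_u; rewrite tp_jordanE u3 uy ua tpZm tpZr conjV2.
lmod.
Qed.

Lemma peirce1_form_sym y k k' : <|u, y, a|> = k *: u -> <|u, a, y|> = k' *: u ->
  k = Num.conj k'.
Proof.
rewrite tpC (tpC u a) => uk uk'; have := tp_jordanE a y u u u.
rewrite u3 uk uk' tpZl tpZr tpZm u3 => h; apply: scale_u.
by apply: (@eq_lincomb1 _ _ (- 1) _ _ _ _ h); lmod.
Qed.

(* [u + a + c] is the image of [u] under the quasi-exponential of [a], an
   element of the structure group, hence it has rank one again. *)
Let v := u + a + c.

Lemma exp_Q2 : <|v, u, v|> = v.
Proof.
rewrite /v !tpD u3 -/c (tpC u u c) (tpC a u u) (tpC c u a) (tpC c u u) ua.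
rewrite peirce1_square (peirce0_Lr u3 _ peirce1_square) (tpC a u c).
rewrite (peirce0_Lr u3 _ peirce1_square); lmod.
Qed.

Lemma exp_Q1 y k : <|u, u, y|> = 2%:R^-1 *: y -> <|u, y, a|> = k *: u ->
  [/\ <|u, y, c|> = k *: a - 2%:R^-1 *: <|a, y, a|>, <|a, y, c|> = k *: c
    & <|v, y, v|> = k *+ 2 *: v].
Proof.
move=> uy uya.
have uyu : <|u, y, u|> = 0.
  have := tripotent_QL u3 y; rewrite uy tpZm conjV2 => h.
  by apply: (@eq_lincomb1 _ _ (- 2%:R) _ _ _ _ h); lmod.
(* Its eigenvalue under [L(u,u)] would be 0 - 1/2 + 0 = -1/2. *)
have cyc : <|c, y, c|> = 0.
  apply: (@peirce_eigen0 _ _ u u3 (- 2%:R^-1)).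
    by rewrite tp_jordanE peirce1_square uy tpZm conjV2 !tp0; lmod.
  suff -> : - 2%:R^-1 * ((- 2%:R^-1) *+ 2 - 1) * (- 2%:R^-1 - 1)
     = - (3%:R / 2%:R) :> R[i].
    by rewrite oppr_eq0 mulf_neq0 ?invr_eq0 ?pnatr_eq0.
  by field.
have uyc : <|u, y, c|> = k *: a - 2%:R^-1 *: <|a, y, a|>.
  rewrite /c tp_jordanE uya (tpC y u u) uy tpZm conjV2 tpZl tpZr.
  by rewrite (tpC a u u) ua; lmod.
have [k' uay] : exists k', <|u, a, y|> = k' *: u.
  apply: peirce2_u; rewrite tp_jordanE u3 uy ua tpZm tpZr conjV2; lmod.
have ayc : <|a, y, c|> = k *: c.
  rewrite /c tp_JP1 (tpC y a u) uay tpZm -(peirce1_form_sym uya uay) //.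
split=> //.
rewrite /v !tpD uyu cyc (tpC a y u) (tpC c y u) (tpC c y a) uya uyc ayc; lmod.
Qed.

Lemma exp_Q0 y : <|u, u, y|> = 0 ->
  exists k, [/\ <|a, y, a|> = k *: u, <|a, y, c|> = (k / 2%:R) *: a,
    <|c, y, c|> = k *: c & <|v, y, v|> = k *: v].
Proof.
move=> uy.
have [k aya] : exists k, <|a, y, a|> = k *: u.
  by apply: peirce2_u; rewrite tp_jordanE ua uy tp0 tpZl tpZr; lmod.
have ayc : <|a, y, c|> = (k / 2%:R) *: a.
  have h1 := tp_JP1 a y u; have h2 := tp_jordanE a y a u a.
  rewrite -/c aya (tpZl k) (tpZr k) (tpC a u u) ua in h1 h2.
  by apply: (@eq_lincomb2 _ _ 2%:R^-1 2%:R^-1 _ _ _ _ _ _ h1 h2); lmod.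
have cyc : <|c, y, c|> = k *: c.
  have := tp_jordanE c y a u a; rewrite -/c (tpC c y a) ayc (tpC y c u).
  rewrite (peirce0_Ll u3 _ peirce1_square) tp0 tpZl tpZr -/c => ->; lmod.
have uyz z : <|u, y, z|> = 0 by exact: peirce0_Ll.
exists k; split=> //.
rewrite /v !tpD !uyz (tpC a y u) (tpC c y u) (tpC c y a) !uyz aya ayc cyc.
lmod.
Qed.

Lemma exp_rank_one : rank_one v.
Proof.
move=> y; have [k2 [y1 [y0 [-> uy1 uy0 _]]]] := peirce_decomposition y.
have [k1 uy1a] := peirce1_form uy1.
have [k0 [_ _ _ vy0]] := exp_Q0 uy0.
have [_ _ vy1] := exp_Q1 uy1 uy1a.
exists (Num.conj k2 + k1 *+ 2 + k0).
by rewrite !tpDm tpZm exp_Q2 vy1 vy0; lmod.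
Qed.

Lemma exp_neq0 : v != 0.
Proof.
apply/eqP => v0; have : <|u, v, u|> = 0 by rewrite v0 tp0.
rewrite !tpD u3 uau (peirce0_Q u3 peirce1_square) !addr0 => /eqP.
by rewrite (negPf u0).
Qed.

End exponential.

End minimal.

(** * Elements annihilated by the minimal tripotents *)

Definition annihilated x : Prop :=
  forall u, minimal_tripotent u -> <|u, x, u|> = 0.

Lemma annihilated_rank_one x v : annihilated x -> rank_one v -> <|v, x, v|> = 0.
Proof.
move=> xN v1; have [->|v0] := eqVneq v 0; first by rewrite tp0.
have [e [k [e_min ->]]] := rank_one_scale v1 v0.
by rewrite tpZl tpZr xN // !scaler0.
Qed.

(** Let [b] be the Peirce-1 part of [x]. On the exponentials of [b] and [- b] the Peirce-0 part of
    [x] contributes equal scalars, being quadratic in the exponent, and [b] opposite ones; so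
    [{u, b, b} = 0]. With [c = {b, u, b}] this gives [{b, b, b} = - 2 {u, b, c}]. If [c = 0], then
    [b = 0]; otherwise [L(b,b)^2 b = - l b] with [l > 0], against positivity. *)
Lemma annihilated_peirce0 x u :
  annihilated x -> minimal_tripotent u -> <|u, u, x|> = 0.
Proof.
move=> xN u_min; have u0 := minimal_neq0 u_min; have [u3 _ _] := u_min.
have [k2 [b [x0 [xE ub ux0 uxu]]]] := peirce_decomposition u_min x.
have {uxu} k20 : k2 = 0.
  move: uxu; rewrite xN // => /esym/eqP; rewrite scaler_eq0 (negPf u0) orbF.
  by rewrite fmorph_eq0 => /eqP.
rewrite {}k20 scale0r add0r in xE.
suff b0 : b = 0 by rewrite xE b0 add0r.
have uNb : <|u, u, - b|> = 2%:R^-1 *: - b by rewrite tpNr ub scalerN.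
have [k1 ubb] := peirce1_form u_min ub ub.
have ubNb : <|u, b, - b|> = - k1 *: u by rewrite tpNr ubb scaleNr.
have [ubc bbc vbv] := exp_Q1 u_min ub ub ubb.
have [_ _ vbv'] := exp_Q1 u_min uNb ub ubNb.
have [k0 [bx0b _ _ vx0v]] := exp_Q0 u_min ub ux0.
have [k0' [bx0b' _ _ vx0v']] := exp_Q0 u_min uNb ux0.
have k0k0' : k0 = k0'.
  rewrite !tpN opprK bx0b in bx0b'; move/eqP: bx0b'.
  by rewrite -subr_eq0 -scalerBl scaler_eq0 (negPf u0) orbF subr_eq0 => /eqP.
have coef0 a (ua : <|u, u, a|> = 2%:R^-1 *: a) k k' :
    <|u + a + <|a, u, a|>, b, u + a + <|a, u, a|> |> =
      k *: (u + a + <|a, u, a|>) ->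
    <|u + a + <|a, u, a|>, x0, u + a + <|a, u, a|> |> =
      k' *: (u + a + <|a, u, a|>) -> k + k' = 0.
  move=> vb vx0; have := annihilated_rank_one xN (exp_rank_one u_min ua).
  rewrite {1}xE tpDm vb vx0 -scalerDl => /eqP.
  by rewrite scaler_eq0 (negPf (exp_neq0 u_min ua)) orbF => /eqP.
have k10 : k1 = 0.
  have h1 := coef0 _ ub _ _ vbv vx0v; have h2 := coef0 _ uNb _ _ vbv' vx0v'.
  rewrite -{}k0k0' mulNrn in h2.
  have : k1 *+ 4 = (k1 *+ 2 + k0) - (- (k1 *+ 2) + k0) by ring.
  by rewrite h1 h2 subrr => /eqP; rewrite mulrn_eq0 => /eqP.
rewrite {}k10 !scale0r {coef0 vbv vbv' ubNb} in ubb ubc bbc.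
set c := <|b, u, b|> in ubc bbc *.
have uc : <|u, u, c|> = 0 by exact: peirce1_square.
have [l [bcb bcc ccc _]] := exp_Q0 u_min ub uc.
rewrite -/c in bcc ccc.
have LLb : <|b, b, <|b, b, b|>|> = - l *: b.
  have b3 : <|b, b, b|> = - 2%:R *: <|u, b, c|>.
    by apply: (@eq_lincomb1 _ _ 2%:R _ _ _ _ ubc); lmod_in R[i] E.
  have h1 := tp_jordanE b b u b c.
  rewrite (tpC b b u) ubb bbc !tp0 b3 tpZm rmorphN rmorph_nat in h1.
  have h2 := tp_jordanE b c u u c.
  rewrite uc (tpC b c u) (peirce0_Ll u3 b uc) !tp0 (tpC c b u) bcc tpZr ub in h2.
  rewrite b3 tpZr.
  apply: (@eq_lincomb2 _ _ (- 2%:R) (- 4%:R) _ _ _ _ _ _ h1 h2).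
  by lmod_in R[i] E.
have [c0|c0] := eqVneq c 0.
  apply: tp_cube_eq0; rewrite c0 tp0 in ubc.
  by apply: (@eq_lincomb1 _ _ 2%:R _ _ _ _ ubc); lmod_in R[i] E.
have b0 : b != 0 by apply: contra c0 => /eqP b0; rewrite /c b0 tp0.
have l_ge0 : 0 <= l := spectrum_eigen ccc c0.
have l0 : l != 0.
  apply: contra c0 => /eqP l0; apply/eqP/tp_cube_eq0.
  by rewrite ccc l0 scale0r.
pose w := 'i * sqrtC l.
have w2 : w ^+ 2 = - l by rewrite exprMn sqrCi sqrtCK mulN1r.
have noteig k y : k ^+ 2 = - l -> y != 0 -> <|b, b, y|> = k *: y -> False.
  move=> kk y0 by_; have k_ge0 : 0 <= k := spectrum_eigen by_ y0.
  have := exprn_ge0 2 k_ge0; rewrite kk oppr_ge0 => l_le0.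
  by move/eqP: l0; apply; apply/le_anti; rewrite l_le0.
(* Since [(L(b,b) - w) (L(b,b) + w) b = 0], either [b] or [(L(b,b) + w) b] is an eigenvector, with
   eigenvalue [- w] or [w], neither of which is a non-negative real. *)
have [d0|d0] := eqVneq (<|b, b, b|> + w *: b) 0.
  exfalso; apply: (noteig (- w) b) => //; first by rewrite sqrrN.
  by apply: (@eq_lincomb1 _ _ 1 _ _ _ _ d0); lmod_in R[i] E.
exfalso; apply: (noteig w _ w2 d0).
rewrite tpDr LLb tpZr scalerDr scalerA -expr2 w2; lmod_in R[i] E.
Qed.

End rank_one_elements.

(** * Real-valued norms *)

Section real_valued_norm.
Variables (R : realType) (V : normedModType R[i]).
Implicit Types (x y : V) (k : R[i]) (r : R).

(** Norms over [R[i]] take values in [R[i]]; estimates are made in the ordered field [R], where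
    [lra] and [nra] apply. *)
Definition nm x : R := complex.Re `|x|.

Lemma nmE x : `|x| = (nm x)%:C%C.
Proof. by rewrite /nm RRe_real // normr_real. Qed.

Lemma lec_nm x r : (`|x| <= r%:C%C) = (nm x <= r).
Proof. by rewrite nmE lecR. Qed.

Lemma nm_ge0 x : 0 <= nm x.
Proof. by rewrite -lecR -nmE normr_ge0. Qed.

Lemma nm0 : nm 0 = 0.
Proof. by rewrite /nm normr0. Qed.

Lemma nm_eq0 x : (nm x == 0) = (x == 0).
Proof.
by rewrite -[RHS]normr_eq0 nmE eq_complex /= eqxx andbT.
Qed.

Lemma nm_gt0 x : (0 < nm x) = (x != 0).
Proof. by rewrite lt_def nm_ge0 andbT nm_eq0. Qed.

Lemma nmD x y : nm (x + y) <= nm x + nm y.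
Proof.
rewrite -lecR -nmE (le_trans (ler_normD x y)) // !nmE.
by rewrite -[X in _ <= X]/((real_complex R) _) rmorphD.
Qed.

Lemma nmN x : nm (- x) = nm x.
Proof. by rewrite /nm normrN. Qed.

Lemma nmB x y : nm (x - y) <= nm x + nm y.
Proof. by rewrite -(nmN y) nmD. Qed.

Lemma nmZ k x : nm (k *: x) = complex.Re `|k| * nm x.
Proof.
have hk : `|k| = (complex.Re `|k|)%:C%C by rewrite RRe_real // normr_real.
by rewrite {1}/nm normrZ hk nmE -rmorphM.
Qed.

Lemma Re_normr_real r : complex.Re `|r%:C%C| = `|r|.
Proof. by rewrite normc_def /= expr0n addr0 sqrtr_sqr. Qed.

Lemma nmZr r x : nm (r%:C%C *: x) = `|r| * nm x.
Proof. by rewrite nmZ Re_normr_real. Qed.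

Lemma near0_nm (P : V -> Prop) : (\forall x \near (0 : V), P x) ->
  exists2 r, 0 < r & forall x, nm x < r -> P x.
Proof.
move=> /nbhs_ballP[e /= e0 Pe].
have eE : e = (complex.Re e)%:C%C by rewrite RRe_real // gtr0_real.
exists (complex.Re e); first by rewrite -ltcR -eE.
move=> x xr; apply: Pe; rewrite -ball_normE /ball_ /= sub0r normrN nmE eE.
by rewrite ltcR.
Qed.

End real_valued_norm.

Lemma cabs_ge0 (R : realType) (k : R[i]) : 0 <= complex.Re `|k|.
Proof. exact: (@nm_ge0 R R[i]^o). Qed.

Lemma cabsM (R : realType) (k k' : R[i]) :
  complex.Re `|k * k'| = complex.Re `|k| * complex.Re `|k'|.
Proof. exact: (@nmZ R R[i]^o). Qed.

Lemma cabs_real (R : realType) (t : R) :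
  0 <= t -> complex.Re `|t%:C%C : R[i]| = t.
Proof. by move=> t0; rewrite Re_normr_real ger0_norm. Qed.

Section triple_bound.
Variables (R : realType) (E : jbTriple R).
Implicit Types (x y z : E).

Lemma tp_bounded : exists2 C : R, 0 < C &
  forall x y z, nm <|x, y, z|> <= C * nm x * nm y * nm z.
Proof.
have cont := tp_continuous (jb_axioms E) (x := ((0 : E), (0 : E), (0 : E))).
have : \forall p \near ((0 : E), (0 : E), (0 : E)),
    `|<|p.1.1, p.1.2, p.2|>| < (1 : R[i]).
  move/cvgrPdist_lt : cont => /(_ 1 ltr01) /=; rewrite tp0.
  by apply: filterS => p; rewrite sub0r normrN.
move=> /nbhs_ballP[e /= e0 Pe].
have eE : e = (complex.Re e)%:C%C by rewrite RRe_real // gtr0_real.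
set r := complex.Re e in eE; have r0 : 0 < r by rewrite -ltcR -eE.
have small x y z : nm x < r -> nm y < r -> nm z < r -> nm <|x, y, z|> <= 1.
  move=> xr yr zr; rewrite -lecR -nmE; apply/ltW.
  apply: (Pe (x, y, z)); split=> /=; first split=> /=;
  by rewrite -ball_normE /ball_ /= sub0r normrN nmE eE ltcR.
have r20 : 0 < r / 2 by rewrite divr_gt0.
exists ((r / 2)^-1 ^+ 3); first by rewrite exprn_gt0 // invr_gt0.
move=> x y z.
have [->|x0] := eqVneq x 0; first by rewrite tp0 !nm0 !(mul0r, mulr0).
have [->|y0] := eqVneq y 0; first by rewrite tp0 !nm0 !(mul0r, mulr0).
have [->|z0] := eqVneq z 0; first by rewrite tp0 !nm0 !(mul0r, mulr0).
pose s (w : E) := (r / 2) / nm w.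
have s0 (w : E) : w != 0 -> 0 < s w by move=> w0; rewrite divr_gt0 // nm_gt0.
have sw (w : E) : w != 0 -> nm ((s w)%:C%C *: w) < r.
  move=> w0; rewrite nmZr gtr0_norm ?s0 // divfK ?nm_eq0 //.
  by rewrite ltr_pdivrMr // ltr_pMr // ltr1n.
have := small _ _ _ (sw _ x0) (sw _ y0) (sw _ z0).
have conjr (t : R) : Num.conj (t%:C%C : R[i]) = t%:C%C.
  by apply: conj_Creal; rewrite complex_real.
rewrite tpZl tpZm tpZr conjr !nmZr !gtr0_norm ?s0 //.
have xp : 0 < nm x by rewrite nm_gt0.
have yp : 0 < nm y by rewrite nm_gt0.
have zp : 0 < nm z by rewrite nm_gt0.
rewrite /s => h.
have -> : (r / 2)^-1 ^+ 3 * nm x * nm y * nm z =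
  ((r / 2 / nm x) * (r / 2 / nm y) * (r / 2 / nm z))^-1.
  by field; rewrite !gt_eqF.
rewrite -[X in _ <= X]mul1r ler_pdivlMr ?mulr_gt0 ?invr_gt0 //.
by apply: le_trans h; rewrite le_eqVlt; apply/orP; left; apply/eqP; ring.
Qed.

Lemma nm_cube x : nm <|x, x, x|> = nm x ^+ 3.
Proof.
apply: (@complexI R); rewrite -nmE (tp_norm (jb_axioms E)) nmE.
by rewrite -rmorphXn.
Qed.

End triple_bound.

(** * Spectral radius *)

Section resolvent_growth.
Variables (R : realType) (V : normedModType R[i]) (A : {linear V -> V}).
Implicit Types (x y : V) (mu : R[i]) (r s t : R).

Local Notation cabs mu := (complex.Re `|mu : R[i]|).

Lemma iter_linearZ n mu x : iter n A (mu *: x) = mu *: iter n A x.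
Proof. by elim: n => //= n ->; rewrite linearZ. Qed.

Definition power_step k mu x : V := mu ^+ (2 ^ k) *: iter (2 ^ k) A x.

Lemma power_stepS k mu x :
  power_step k.+1 mu x = power_step k mu (power_step k mu x).
Proof.
rewrite /power_step iter_linearZ scalerA -exprD -iterD.
by rewrite addnn -mul2n -expnS.
Qed.

Lemma power_stepM k mu mu' x :
  power_step k (mu * mu') x = mu ^+ (2 ^ k) *: power_step k mu' x.
Proof. by rewrite /power_step exprMn scalerA. Qed.

(** Multiplying [mu] by this root changes the sign of [(mu A)^(2^k)]. *)
Definition dyadic_root k : R[i] := (2 ^ k)%N.-root (- 1).

Lemma dyadic_rootK k : dyadic_root k ^+ (2 ^ k) = - 1.
Proof. by rewrite rootCK // expn_gt0. Qed.

Lemma cabs_dyadic_root k : cabs (dyadic_root k) = 1.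
Proof.
have h : `|dyadic_root k| ^+ (2 ^ k) = 1.
  by rewrite -normrX dyadic_rootK normrN1.
suff -> : `|dyadic_root k| = 1 by [].
apply/eqP; rewrite -(@eqrXn2 _ (2 ^ k)%N) ?expn_gt0 ?ler01 //.
by rewrite h expr1n.
Qed.

Variables (a M r th : R) (G : R[i] -> V -> V).
Hypotheses (r_ge0 : 0 <= r) (th_gt0 : 0 < th) (th_lt1 : th < 1).
Hypotheses (a_ge0 : 0 <= a) (M_ge0 : 0 <= M).
Hypothesis A_bound : forall x, nm (A x) <= a * nm x.
Hypothesis G_bound : forall mu x, cabs mu <= r ->
  nm x <= M * nm (x - mu *: A x).
Hypothesis GK : forall mu x, cabs mu <= r -> G mu (x - mu *: A x) = x.
Hypothesis KG : forall mu x, cabs mu <= r -> G mu x - mu *: A (G mu x) = x.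
Hypothesis th_close : (1 - th ^+ 2) * (M * r * a * M) <= 3%:R^-1.

Fixpoint average k mu x : V :=
  if k is k'.+1 then
    2%:R^-1 *: (average k' mu x + average k' (dyadic_root k' * mu) x)
  else G mu x.

(* The partial fraction
   [1 / (1 - B^2) = (1 / (1 - B) + 1 / (1 + B)) / 2] with [B = (mu A)^(2^k)]. *)
Lemma averageP k mu : cabs mu <= r ->
  (forall x y, y - power_step k mu y = x -> average k mu x = y) /\
  (forall x, average k mu x - power_step k mu (average k mu x) = x).
Proof.
have addpw j nu x y :
    power_step j nu (x + y) = power_step j nu x + power_step j nu y.
  rewrite /power_step -scalerDr; congr (_ *: _).
  by elim: (2 ^ j)%N => //= n ->; rewrite linearD.
have scalepw j nu b x : power_step j nu (b *: x) = b *: power_step j nu x.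
  by rewrite /power_step iter_linearZ !scalerA mulrC.
have oppw j nu x : power_step j nu (- x) = - power_step j nu x.
  by rewrite -scaleN1r scalepw scaleN1r.
elim: k mu => [|k IH] mu mur.
  by split=> [x y <-|x]; rewrite /power_step expr1 /= (GK, KG).
have mur' : cabs (dyadic_root k * mu) <= r.
  by rewrite cabsM cabs_dyadic_root mul1r.
have [l1 r1] := IH _ mur; have [l2 r2] := IH _ mur'.
have pwN x : power_step k (dyadic_root k * mu) x = - power_step k mu x.
  by rewrite power_stepM dyadic_rootK scaleN1r.
split=> [x y yx|x] /=.
  rewrite (l1 x (y + power_step k mu y)); last first.
    by rewrite -yx addpw -power_stepS; lmod_in R[i] V.
  rewrite (l2 x (y - power_step k mu y)); last first.
    rewrite pwN -yx addpw oppw -power_stepS.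
    by lmod_in R[i] V.
  by lmod_in R[i] V.
rewrite power_stepS.
have := r1 x; have := r2 x; rewrite pwN.
set u := average k mu x; set v := average k _ x => hv hu.
have hu' : power_step k mu u = u - x.
  by apply: (@eq_lincomb1 _ _ (- 1) _ _ _ _ hu); lmod_in R[i] V.
have hv' : power_step k mu v = x - v.
  by apply: (@eq_lincomb1 _ _ 1 _ _ _ _ hv); lmod_in R[i] V.
move: hu' hv' (addpw k mu) (scalepw k mu) (oppw k mu) => {hu hv}.
move: (power_step k mu) => P hu hv addP scaleP oppP.
by rewrite !(scaleP, addP) hu hv !(addP, oppP) hu hv; lmod_in R[i] V.
Qed.

(** For [k = 0] this is the resolvent identity with the uniform bound [M] and the choice of [th].
    Averaging over roots of unity preserves the bound, which is therefore independent of [k]. *)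
Lemma average_close k mu s x : cabs mu <= r -> th ^+ 2 <= s <= 1 ->
  nm (average k mu x - average k (s%:C%C * mu) x) <= 3%:R^-1 * nm x.
Proof.
move=> mur /andP[ths s1]; have s0 : 0 <= s by rewrite (le_trans _ ths) ?sqr_ge0.
elim: k mu mur => [|k IH] mu mur.
  have smur : cabs (s%:C%C * mu) <= r.
    rewrite cabsM cabs_real // (le_trans _ mur) // ler_piMl ?cabs_ge0 //.
  rewrite /average.
  have hu := KG x mur; have hw := KG x smur.
  move: hu hw; set u := G mu x; set w := G (s%:C%C * mu) x => hu hw.
  have wx : nm w <= M * nm x by have := G_bound w smur; rewrite hw.
  have huw : (u - w) - mu *: A (u - w) = ((1 - s)%:C%C * mu) *: A w.
    have -> : (1 - s)%:C%C = 1 - s%:C%C :> R[i] by rewrite rmorphB.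
    have -> : A (u - w) = A u - A w by rewrite linearB.
    apply: (@eq_lincomb2 _ _ 1 (- 1) _ _ _ _ _ _ hu hw).
    by lmod_in R[i] V.
  have := G_bound (u - w) mur; rewrite huw nmZ cabsM cabs_real ?subr_ge0 //.
  move=> /le_trans; apply.
  have h1 : cabs mu * nm (A w) <= r * (a * (M * nm x)).
    apply: ler_pM => //; rewrite ?cabs_ge0 ?nm_ge0 //.
    by rewrite (le_trans (A_bound _)) // ler_wpM2l.
  have : M * ((1 - s) * cabs mu * nm (A w)) <=
      M * ((1 - th ^+ 2) * (r * (a * (M * nm x)))).
    apply: ler_wpM2l => //; rewrite -mulrA; apply: ler_pM => //.
    - by rewrite subr_ge0.
    - by rewrite mulr_ge0 ?cabs_ge0 ?nm_ge0.
    - by rewrite lerD2l lerN2.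
  move=> /le_trans; apply.
  have -> : M * ((1 - th ^+ 2) * (r * (a * (M * nm x)))) =
    ((1 - th ^+ 2) * (M * r * a * M)) * nm x by ring.
  by apply: ler_wpM2r => //; exact: nm_ge0.
rewrite /= mulrCA -scalerBr.
set u := average k mu x; set v := average k (_ * mu) x.
set u' := average k (s%:C%C * mu) x; set v' := average _ _ x.
have hu : nm (u - u') <= 3%:R^-1 * nm x by exact: IH.
have hv : nm (v - v') <= 3%:R^-1 * nm x.
  by apply: IH; rewrite cabsM cabs_dyadic_root mul1r.
have -> : u + v - (u' + v') = (u - u') + (v - v') by lmod_in R[i] V.
have c2 : cabs 2%:R^-1 = 2^-1.
  by rewrite normfV normr_nat -(rmorph_nat (real_complex R)) -fmorphV.
rewrite nmZ c2; have := nmD (u - u') (v - v'); lra.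
Qed.

Definition powers_small t := exists k, forall x,
  nm (power_step k t%:C%C x) <= 4%:R^-1 * nm x.

Lemma powers_small_le t s : 0 <= s <= t -> powers_small t -> powers_small s.
Proof.
move=> /andP[s0 st] [k kt]; exists k => x.
have [t0|t0] := eqVneq t 0.
  by have -> : s = t; [apply/le_anti; rewrite st t0 s0|].
have tp : 0 < t by rewrite lt_def t0 (le_trans s0 st).
have -> : s%:C%C = (s / t)%:C%C * t%:C%C :> R[i].
  by rewrite -rmorphM divfK.
rewrite power_stepM -rmorphXn nmZr ger0_norm ?exprn_ge0 ?divr_ge0 ?(ltW tp) //.
rewrite (le_trans _ (kt x)) // ler_piMl ?nm_ge0 //.
by rewrite exprn_ile1 ?divr_ge0 ?(ltW tp) // ler_pdivrMr // mul1r.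
Qed.

(** Put [mu = t / th^2]. A power at [t] of norm at most 1/4 puts its resolvent within 1/3 of the
    identity, hence the one at [mu] within 2/3; so [1 - (mu A)^(2^k)] has norm at most 3 and
    [(mu A)^(2^k)] at most 4. Passing from [mu] to [t / th = th mu] gains the factor
    [th^(2^k) <= 1/16]. *)
Lemma powers_small_step t : 0 <= t -> t <= r * th ^+ 2 ->
  powers_small t -> powers_small (t / th).
Proof.
move=> t0 tr [k0 k0t].
have small j : forall x, nm (power_step (k0 + j) t%:C%C x) <= 4%:R^-1 * nm x.
  elim: j => [|j IH] x; first by rewrite addn0.
  rewrite addnS power_stepS (le_trans (IH _)) //; have := IH x.
  by have := nm_ge0 (power_step (k0 + j) t%:C%C x); lra.
have [j thj] : exists j, th ^+ (2 ^ (k0 + j)) <= 16%:R^-1.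
  have /cvgrPdist_lt /(_ 16%:R^-1) : (fun n => th ^+ n) @ \oo --> (0 : R).
    by apply: cvg_expr; rewrite gtr0_norm.
  rewrite invr_gt0 ltr0n => /(_ isT)[N _ hN]; exists N.
  have : (N <= 2 ^ (k0 + N))%N.
    by rewrite (leq_trans (leq_addl k0 N)) // ltnW // ltn_expl.
  move=> /hN /=; rewrite sub0r normrN ger0_norm ?exprn_ge0 ?(ltW th_gt0) //.
  exact: ltW.
exists (k0 + j)%N => x; move: (small j) thj; set k := (k0 + j)%N => {}small thj.
set mu := (t / th ^+ 2)%:C%C : R[i].
have mu_abs : cabs mu <= r.
  by rewrite cabs_real ?divr_ge0 ?sqr_ge0 // ler_pdivrMr // exprn_gt0.
have tE : t%:C%C = (th ^+ 2)%:C%C * mu.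
  by rewrite -rmorphM mulrC divfK // gt_eqF // exprn_gt0.
have tr' : cabs t%:C%C <= r.
  rewrite cabs_real // (le_trans tr) // ler_piMr //.
  by rewrite exprn_ile1 // ltW.
have [lmu rmu] := averageP k mu_abs; have [lt rt] := averageP k tr'.
have pwmu y : nm (power_step k mu y) <= 4%:R * nm y.
  pose w := y - power_step k mu y.
  have hw : average k mu w = y by exact: lmu.
  have h1 : nm (y - average k t%:C%C w) <= 3%:R^-1 * nm w.
    rewrite -[X in X - _]hw tE; apply: average_close => //.
    by rewrite lexx exprn_ile1 // ltW.
  have h2 : nm (average k t%:C%C w - w) <= 3%:R^-1 * nm w.
    have hz := rt w; set z := average k t%:C%C w in hz *.
    have zE : w + power_step k t%:C%C z = z by rewrite -hz subrK.
    have -> : z - w = power_step k t%:C%C z by rewrite -{1}zE addrC addKr.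
    have := small z; have := nmD w (power_step k t%:C%C z); rewrite zE; lra.
  have h3 : nm w <= nm y + nm (y - w).
    by rewrite -[X in nm X <= _](subKr y) nmB.
  have h4 : nm (y - w) <= nm (y - average k t%:C%C w) + nm (average k t%:C%C w - w).
    have := nmD (y - average k t%:C%C w) (average k t%:C%C w - w).
    by rewrite addrA subrK.
  have h5 : nm (power_step k mu y) <= nm y + nm w.
    have -> : power_step k mu y = y - w by rewrite /w subKr.
    exact: nmB.
  lra.
have -> : (t / th)%:C%C = th%:C%C * mu.
  by rewrite -rmorphM; congr (_%:C%C); field; rewrite gt_eqF.
rewrite power_stepM -rmorphXn nmZr ger0_norm ?exprn_ge0 ?(ltW th_gt0) //.
have := pwmu x; have := nm_ge0 (power_step k mu x); have := nm_ge0 x.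
set q := nm (power_step k mu x) => p0 q0 qp.
have : th ^+ (2 ^ k) * q <= 16%:R^-1 * q by rewrite ler_wpM2r.
lra.
Qed.

(** Steps of ratio [1 / th] climb from [t] to [r * th]; the cap at [r * th] keeps the start of each
    step below [r * th ^+ 2]. *)
Lemma powers_small_radius t : 0 < t -> powers_small t -> powers_small (r * th).
Proof.
move=> t0 small_t.
have th_inv : 1 < th^-1 by rewrite invf_gt1.
have minp n : 0 <= Num.min (t / th ^+ n) (r * th).
  by rewrite le_min divr_ge0 ?mulr_ge0 ?exprn_ge0 ?(ltW th_gt0) ?(ltW t0).
have small n : powers_small (Num.min (t / th ^+ n) (r * th)).
  elim: n => [|n IH].
    apply: powers_small_le small_t; rewrite expr0 divr1.
    by rewrite ge_min lexx /= andbT; have := minp 0%N; rewrite expr0 divr1.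
  set m := Num.min _ _.
  have m0 : 0 <= m by exact: minp.
  have -> : m = m * th / th by rewrite mulfK // gt_eqF.
  apply: powers_small_step.
  - by rewrite mulr_ge0 // ltW.
  - by rewrite expr2 mulrA ler_pM2r // ge_min lexx orbT.
  - apply: powers_small_le IH; rewrite mulr_ge0 ?(ltW th_gt0) //= le_min.
    apply/andP; split.
      rewrite -ler_pdivlMr // -mulrA -invfM -exprSr.
      by rewrite ge_min lexx.
    rewrite (@le_trans _ _ m) //; first by rewrite ler_piMr // ltW.
    by rewrite ge_min lexx orbT.
have [n hn] : exists n, r * th <= t / th ^+ n.
  have /cvgrPdist_lt /(_ (t / (r * th + 1))) : (fun n => th ^+ n) @ \oo --> (0 : R).
    by apply: cvg_expr; rewrite gtr0_norm.
  have rth : 0 < r * th + 1 by rewrite ltr_wpDl // mulr_ge0 // ltW.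
  rewrite divr_gt0 // => /(_ isT)[N _ /(_ N (leqnn N))] /=.
  rewrite sub0r normrN ger0_norm ?exprn_ge0 ?(ltW th_gt0) // => h; exists N.
  rewrite ler_pdivlMr ?exprn_gt0 //; rewrite ltr_pdivlMr // in h.
  have := exprn_gt0 N th_gt0; nra.
by have := small n; rewrite (min_idPr hn).
Qed.

End resolvent_growth.

Section spectral_radius.
Variables (R : realType) (V : normedModType R[i]) (A : {linear V -> V}).
Implicit Types (x y : V) (mu : R[i]) (r s t : R).

Local Notation cabs mu := (complex.Re `|mu : R[i]|).

Lemma cabs_le_add mu : cabs mu <= `|complex.Re mu| + `|complex.Im mu|.
Proof.
rewrite normc_def /= -[leRHS]ger0_norm ?addr_ge0 // -sqrtr_sqr ler_wsqrtr //.
rewrite sqrrD !real_normK ?num_real // -addrA lerD2l lerDr.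
by rewrite mulrn_wge0 // mulr_ge0.
Qed.

Lemma compact_disc r : compact [set z : R * R | z.1 ^+ 2 + z.2 ^+ 2 <= r ^+ 2].
Proof.
pose B : set (R * R) := `[- `|r|, `|r|]%classic `*` `[- `|r|, `|r|]%classic.
have cB : compact B by apply: compact_setX; exact: segment_compact.
apply: (subclosed_compact _ cB).
  rewrite (_ : [set _ | _] =
    (fun z : R * R => z.1 ^+ 2 + z.2 ^+ 2) @^-1` [set u | u <= r ^+ 2]) //.
  apply: closed_comp; last exact: closed_le.
  move=> z _; apply: cvgD; (apply: cvgM; first [exact: cvg_fst | exact: cvg_snd]).
move=> [p q] /= pq; have bnd (u v : R) : u ^+ 2 + v ^+ 2 <= r ^+ 2 ->
    u \in `[- `|r|, `|r|]%R.
  move=> uv; rewrite in_itv /= -ler_norml -ler_sqr ?nnegrE // !real_normK ?num_real //.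
  by rewrite (le_trans _ uv) // lerDl sqr_ge0.
by split=> /=; [exact: bnd pq|apply: (bnd q p); rewrite addrC].
Qed.

Variable a : R.
Hypothesis a_ge0 : 0 <= a.
Hypothesis A_bound : forall x, nm (A x) <= a * nm x.

(** A lower bound at one [mu] persists nearby with a doubled constant, and the disc is compact. *)
Lemma uniform_lower_bound r :
  (forall mu, cabs mu <= r ->
    exists2 C, 0 < C & forall x, nm x <= C * nm (x - mu *: A x)) ->
  exists2 M, 0 < M &
    forall mu x, cabs mu <= r -> nm x <= M * nm (x - mu *: A x).
Proof.
move=> lower; have [r0|r0] := ltP r 0.
  exists 1 => // mu x /le_lt_trans/(_ r0).
  by rewrite ltNge cabs_ge0.
pose P (M : R) (z : R * R) :=
  forall x, nm x <= M * nm (x - Complex z.1 z.2 *: A x).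
suff : \forall M \near +oo%R, [set z : R * R | z.1 ^+ 2 + z.2 ^+ 2 <= r ^+ 2] `<=` P M.
  move=> [M0 [_ hM0]]; pose M := Num.max (M0 + 1) 1.
  exists M; first by rewrite lt_max ltr01 orbT.
  move=> [p q] x mur; apply: (hM0 M _ (p, q)) => /=.
    by rewrite lt_max ltrDl ltr01.
  have := mur; rewrite normc_def /= => h.
  rewrite -[leLHS]sqr_sqrtr ?addr_ge0 ?sqr_ge0 //.
  by rewrite ler_sqr // nnegrE ?sqrtr_ge0.
apply: (iffLR (compact_near_coveringP _) (@compact_disc r)) => -[p0 q0] /= pq0.
have [|C C0 hC] := lower (Complex p0 q0).
  by rewrite normc_def /= -(ger0_norm r0) -sqrtr_sqr ler_wsqrtr.
(* A change of [mu] by at most [2 d] costs at most half of [nm x]. *)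
pose d := (2 * (2 * C * (a + 1)))^-1.
have d0 : 0 < d by rewrite invr_gt0 !mulr_gt0 // ltr_wpDl.
exists ([set z : R * R | `|p0 - z.1| < d /\ `|q0 - z.2| < d],
        [set M | 2 * C <= M]) => /=.
  split; first last.
    by exists (2 * C); split; [exact: num_real|move=> M /ltW].
  by apply/nbhs_ballP; exists d => // -[p q] [/= h1 h2]; split.
move=> [[p q] M] /= [[hp hq] hM] x.
have := hC x; set y := x - Complex p q *: A x.
have -> : x - Complex p0 q0 *: A x = y - (Complex p0 q0 - Complex p q) *: A x.
  by rewrite /y; lmod_in R[i] V.
set mu := Complex p0 q0 - Complex p q.
have hmu : cabs mu <= 2 * d.
  by have := cabs_le_add mu; rewrite /=; lra.
have h1 : nm (mu *: A x) <= 2 * d * (a * nm x).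
  by rewrite nmZ ler_pM // ?nm_ge0 // cabs_ge0.
have h2 : C * nm (y - mu *: A x) <= C * (nm y + 2 * d * (a * nm x)).
  by rewrite ler_pM2l // (le_trans (nmB _ _)) // lerD2l.
have h3 : C * (2 * d * (a * nm x)) <= 2^-1 * nm x.
  have -> : C * (2 * d * (a * nm x)) = 2^-1 * (a / (a + 1) * nm x).
    by rewrite /d; field; rewrite !gt_eqF // ltr_wpDl.
  rewrite ler_pM2l ?invr_gt0 // ler_piMl ?nm_ge0 //.
  by rewrite ler_pdivrMr ?mul1r ?lerDl // ltr_wpDl.
have h4 : 2 * C * nm y <= M * nm y by rewrite ler_wpM2r // nm_ge0.
rewrite mulrDr in h2; lra.
Qed.

(* Gelfand's formula without complex integration (Rickart): the averages of
   the resolvent over the roots of unity are the resolvents of the powers. *)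
Lemma power_growth :
  (forall mu, cabs mu < 1 -> exists G : V -> V, exists C, [/\ 0 < C,
    forall x, nm (G x) <= C * nm x, forall x, G (x - mu *: A x) = x
    & forall x, G x - mu *: A (G x) = x]) ->
  forall s, 0 < s < 1 ->
  exists2 C, 0 < C & forall n x, s ^+ n * nm (iter n A x) <= C * nm x.
Proof.
move=> resolvent s /andP[s0 s1].
pose r := (1 + s) / 2.
have r1 : r < 1 by rewrite /r; lra.
have sr : s < r by rewrite /r; lra.
have r0 : 0 < r by rewrite (lt_trans s0).
have [M M0 hM] : exists2 M, 0 < M &
    forall mu x, cabs mu <= r -> nm x <= M * nm (x - mu *: A x).
  apply: uniform_lower_bound => mu mur.
  have [G [C [C0 GC GK KG]]] := resolvent mu (le_lt_trans mur r1).
  by exists C => // x; rewrite -{1}(GK x).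
have /(@boolp.choice _ _ _)[G hG] : forall mu, exists G : V -> V, cabs mu <= r ->
    (forall x, G (x - mu *: A x) = x) /\ (forall x, G x - mu *: A (G x) = x).
  move=> mu; have [mur|mur] := leP (cabs mu) r; last by exists id.
  have [G [C [_ _ GK KG]]] := resolvent mu (le_lt_trans mur r1).
  by exists G.
pose K := M * r * a * M.
have K0 : 0 <= K.
  rewrite /K; apply: mulr_ge0; rewrite ?(ltW M0) //; apply: mulr_ge0 => //.
  by apply: mulr_ge0; apply: ltW.
(* With [th = 1 - d] the three terms ensure [0 < th], [s <= r * th], and
   [(1 - th^2) K <= 2 d K <= 1/3]. *)
pose d := Num.min 2^-1 (Num.min (1 - s / r) (6 * (K + 1))^-1).
have K6 : 0 < 6 * (K + 1) by rewrite mulr_gt0 // ltr_wpDl.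
have d0 : 0 < d.
  rewrite !lt_min invr_gt0 ltr0n subr_gt0 ltr_pdivrMr // mul1r sr /=.
  by rewrite invr_gt0.
have d2 : d <= 2^-1 by rewrite ge_min lexx.
have dr : d <= 1 - s / r by rewrite !ge_min lexx !orbT.
have dK : d <= (6 * (K + 1))^-1 by rewrite !ge_min lexx !orbT.
pose th := 1 - d.
have th0 : 0 < th by rewrite /th; lra.
have th1 : th < 1 by rewrite /th; lra.
have th_close : (1 - th ^+ 2) * K <= 3%:R^-1.
  have h : d * (6 * (K + 1)) <= 1 by rewrite -ler_pdivlMr // mul1r.
  have := mulr_ge0 (sqr_ge0 d) K0; rewrite /th; nra.
have small_t : powers_small A (4 * (a + 1))^-1.
  exists 0%N => x; rewrite /power_step /= expr1 nmZr gtr0_norm; last first.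
    by rewrite invr_gt0 mulr_gt0 // ltr_wpDl.
  apply: (@le_trans _ _ ((4 * (a + 1))^-1 * (a * nm x))).
    by rewrite ler_pM2l // invr_gt0 mulr_gt0 // ltr_wpDl.
  rewrite mulrA ler_wpM2r ?nm_ge0 // invfM -mulrA ger_pMr ?invr_gt0 //.
  by rewrite mulrC ler_pdivrMr ?mul1r ?lerDl // ltr_wpDl.
have [k hk] : powers_small A s.
  apply: (@powers_small_le _ _ _ (r * th)).
    rewrite (ltW s0) /= -ler_pdivrMl // mulrC /th; lra.
  apply: (powers_small_radius (ltW r0) th0 th1 a_ge0 (ltW M0) A_bound hM
    _ _ th_close _ small_t) => [mu x mur|mu x mur|].
  - by have [] := hG mu mur.
  - by have [] := hG mu mur.
  - by rewrite invr_gt0 mulr_gt0 // ltr_wpDl.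
pose b := Num.max a 1.
have b1 : 1 <= b by rewrite le_max lexx orbT.
have iterb n x : nm (iter n A x) <= b ^+ n * nm x.
  elim: n => [|n IH] /=; first by rewrite mul1r.
  rewrite (le_trans (A_bound _)) // exprS -mulrA ler_pM ?nm_ge0 //.
  by rewrite le_max lexx.
exists (b ^+ (2 ^ k)); first by rewrite exprn_gt0 // (lt_le_trans ltr01).
(* Each block of [2 ^ k] factors [s A] does not increase the norm; the constant pays for the
   remaining fewer than [2 ^ k] factors. *)
move=> n; have [m] := ubnP n; elim: m n => // m IH n nm_ x.
have [nk|kn] := ltnP n (2 ^ k).
  apply: (@le_trans _ _ (nm (iter n A x))).
    by rewrite ler_piMl ?nm_ge0 // exprn_ile1 // ltW.
  rewrite (le_trans (iterb n x)) // ler_wpM2r ?nm_ge0 //.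
  by rewrite ler_weXn2l // ltnW.
have nE : (2 ^ k + (n - 2 ^ k) = n)%N by rewrite subnKC.
have lt_m : (n - 2 ^ k < m)%N.
  apply: (@leq_trans n) => //.
  by rewrite ltn_subrL expn_gt0 (leq_trans _ kn) // expn_gt0.
apply: le_trans (IH _ lt_m x).
have -> : iter n A x = iter (2 ^ k) A (iter (n - 2 ^ k) A x).
  by rewrite -iterD nE.
have -> : s ^+ n = s ^+ (n - 2 ^ k) * s ^+ (2 ^ k) by rewrite -exprD addnC nE.
set y := iter (n - _) A x; rewrite -mulrA ler_wpM2l ?exprn_ge0 ?(ltW s0) //.
have := hk y.
rewrite /power_step -rmorphXn nmZr ger0_norm ?exprn_ge0 ?(ltW s0) //.
move=> /le_trans; apply.
by rewrite ler_piMl ?nm_ge0 // invf_le1 // ler1n.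
Qed.

End spectral_radius.

(** * Functional calculus *)

Lemma linear_continuous_bounded (R : realType) (V W : normedModType R[i])
    (f : V -> W) :
  (forall k x, f (k *: x) = k *: f x) -> continuous_at 0 f ->
  exists2 C, 0 < C & forall x, nm (f x) <= C * nm x.
Proof.
move=> fZ fc; have f0 : f 0 = 0 by rewrite -(scale0r 0) fZ scale0r.
have : \forall x \near (0 : V), nm (f x) <= 1.
  move/cvgrPdist_lt : fc => /(_ 1 ltr01) /=; rewrite f0.
  by apply: filterS => x; rewrite sub0r normrN -lec_nm => /ltW.
move=> /near0_nm[r r0 hr]; exists (2 / r); first by rewrite divr_gt0.
move=> x; have [->|x0] := eqVneq x 0; first by rewrite f0 !nm0 mulr0.
have xp : 0 < nm x by rewrite nm_gt0.
have r2 : 0 < r / 2 / nm x by rewrite !divr_gt0.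
have := hr ((r / 2 / nm x)%:C%C *: x); rewrite fZ !nmZr gtr0_norm //.
rewrite divfK ?gt_eqF // => h.
have -> : nm (f x) = r / 2 / nm x * nm (f x) * (2 / r * nm x).
  by field; rewrite !gt_eqF.
rewrite -[leRHS]mul1r ler_wpM2r ?h ?mulr_ge0 ?invr_ge0 ?(ltW r0) ?(ltW xp) //.
lra.
Qed.

(** * Resolvent invariance of closed subspaces *)

Section invariant_subspaces.
Variables (R : realType) (V : normedModType R[i]) (L : {linear V -> V}).
Implicit Types (u v w : V) (s t : R).

Record closed_subspace (W : V -> Prop) : Prop := ClosedSubspace {
  closed_subspaceD : forall u v, W u -> W v -> W (u + v) ;
  closed_subspaceZ : forall k u, W u -> W (k *: u) ;
  closed_subspace_lim : forall u,
    (forall e : R, 0 < e -> exists2 w, W w & nm (u - w) < e) -> W u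
}.

Variable W : V -> Prop.
Hypothesis W_closed : closed_subspace W.
Hypothesis W_L : forall u, W u -> W (L u).

(** The iterates of [q] from 0 stay in [W] and converge geometrically to [u]. Below, [q] is the
    fixed-point map of a Neumann series. *)
Lemma invariant_approx u (q : V -> V) :
  W 0 -> (forall w, W w -> W (q w) /\ nm (u - q w) <= 2^-1 * nm (u - w)) -> W u.
Proof.
move=> W0 hq; apply: (closed_subspace_lim W_closed) => e e0.
have [n hn] : exists n, 2^-1 ^+ n * (nm u + 1) < e.
  have u1 : 0 < nm u + 1 by rewrite ltr_wpDl // nm_ge0.
  have /cvgrPdist_lt /(_ (e / (nm u + 1))) :
      (fun n => 2^-1 ^+ n) @ \oo --> (0 : R).
    by apply: cvg_expr; rewrite gtr0_norm; lra.
  rewrite divr_gt0 // => /(_ isT)[N _ /(_ N (leqnn N))] /=.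
  rewrite sub0r normrN ger0_norm ?exprn_ge0 ?invr_ge0 // ltr_pdivlMr // => h.
  by exists N.
have [Wn hWn] : W (iter n q 0) /\ nm (u - iter n q 0) <= 2^-1 ^+ n * nm u.
  elim: n {hn} => [|n [Wn hWn]] /=; first by rewrite subr0 mul1r.
  have [Wq qle] := hq _ Wn; split=> //.
  by rewrite (le_trans qle) // exprS -mulrA ler_wpM2l // invr_ge0.
exists (iter n q 0) => //; apply: le_lt_trans hn; apply: (le_trans hWn).
by rewrite ler_wpM2l ?exprn_ge0 ?invr_ge0 ?lerDl.
Qed.

Variable a : R.
Hypothesis a_ge0 : 0 <= a.
Hypothesis L_bound : forall u, nm (L u) <= a * nm u.
Hypothesis L_resolvent : forall s, 0 < s -> exists2 C, 0 < C &
  (forall w, nm w <= C * nm (L w + s%:C%C *: w)) /\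
  (forall v, exists w, L w + s%:C%C *: w = v).

Definition resolvent_invariant s :=
  forall w, W (L w + s%:C%C *: w) -> W w.

Let WB u v : W u -> W v -> W (u - v).
Proof.
move=> Wu Wv; rewrite -scaleN1r.
by apply: closed_subspaceD W_closed _ _ Wu _; exact: closed_subspaceZ.
Qed.

Lemma resolvent_invariant_large s : 2 * a + 1 <= s -> resolvent_invariant s.
Proof.
move=> sa w Ww; have s0 : 0 < s by have := a_ge0; lra.
have W0 : W 0 by rewrite -(scale0r (L w + s%:C%C *: w)); exact: closed_subspaceZ.
pose q u := (s^-1)%:C%C *: (L w + s%:C%C *: w - L u).
apply: (@invariant_approx w q) => // u Wu; split.
  by apply: closed_subspaceZ => //; apply: WB => //; exact: W_L.
have -> : w - q u = (- s^-1)%:C%C *: L (w - u).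
  have -> : (- s^-1)%:C%C = - (s%:C%C)^-1 :> R[i] by rewrite rmorphN fmorphV.
  have sC : s%:C%C != 0 :> R[i] by rewrite fmorph_eq0 gt_eqF.
  have -> : L (w - u) = L w - L u by rewrite linearB.
  rewrite /q; have -> : (s^-1)%:C%C = (s%:C%C)^-1 :> R[i] by rewrite fmorphV.
  rewrite scalerBr scalerDr scalerA mulVf // scale1r; lmod_in R[i] V.
rewrite nmZr normrN gtr0_norm ?invr_gt0 // mulrC ler_pdivrMr //.
rewrite (le_trans (L_bound _)) // mulrAC ler_wpM2r ?nm_ge0 //; lra.
Qed.

Lemma resolvent_invariant_near s t C : 0 < s -> 0 < C ->
  (forall w, nm w <= C * nm (L w + s%:C%C *: w)) -> `|s - t| * C <= 2^-1 ->
  resolvent_invariant s -> resolvent_invariant t.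
Proof.
move=> s0 C0 hC st Ps w Ww.
have W0 : W 0 by rewrite -(scale0r (L w + t%:C%C *: w)); exact: closed_subspaceZ.
have [_ _ [_ /(@boolp.choice _ _ _)[S hS]]] := L_resolvent s0.
pose q u := S (L w + t%:C%C *: w + (s - t)%:C%C *: u).
have qE u : L (q u) + s%:C%C *: q u = L w + t%:C%C *: w + (s - t)%:C%C *: u.
  exact: hS.
apply: (@invariant_approx w q) => // u Wu; split.
  apply: Ps; rewrite qE; apply: closed_subspaceD => //.
  exact: closed_subspaceZ.
apply: (le_trans (hC _)).
have -> : L (w - q u) + s%:C%C *: (w - q u) = (s - t)%:C%C *: (w - u).
  have -> : L (w - q u) = L w - L (q u) by rewrite linearB.
  have st' : (s - t)%:C%C = s%:C%C - t%:C%C :> R[i] by rewrite rmorphB.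
  have h := qE u; rewrite st' in h; rewrite st'.
  by apply: (@eq_lincomb1 _ _ (- 1) _ _ _ _ h); lmod_in R[i] V.
by rewrite nmZr mulrA ler_wpM2r ?nm_ge0 // mulrC.
Qed.

(* The resolvent set contains the half-line of negative numbers, so that the
   resolvent at -1 is reached from the Neumann series at large numbers. *)
Lemma invariant_resolvent w : W (L w + w) -> W w.
Proof.
suff P1 : resolvent_invariant 1 by move=> Ww; apply: P1; rewrite scale1r.
apply: contrapT => nP1.
pose bad : set R := [set s | 1 <= s /\ ~ resolvent_invariant s].
have bad1 : bad 1 by split.
have ub_bad : ubound bad (2 * a + 1).
  move=> s [s1 nPs]; rewrite leNgt; apply/negP => /ltW sa.
  exact: nPs (resolvent_invariant_large sa).
have sup_bad : has_sup bad by split; [exists 1|exists (2 * a + 1)].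
pose I := sup bad.
have I1 : 1 <= I by apply: ub_le_sup => //; case: sup_bad.
have I0 : 0 < I by rewrite (lt_le_trans ltr01).
have [C C0 [hC _]] := L_resolvent I0.
(* The bound at [I] persists at the good point [I + d] with constant [2 C]. A bad [s] lies within
   [2 d] of that point, and [2 d * 2 C = 1/2] lets invariance pass to [s], a contradiction. *)
pose d := (8 * C)^-1.
have d0 : 0 < d by rewrite invr_gt0 mulr_gt0.
have dC : d * C = 8^-1 by rewrite /d; field; rewrite gt_eqF.
have hC2 w' : nm w' <= (2 * C) * nm (L w' + (I + d)%:C%C *: w').
  have h1 := hC w'; set y := L w' + (I + d)%:C%C *: w'.
  have yE : L w' + I%:C%C *: w' = y - d%:C%C *: w'.
    have Id : (I + d)%:C%C = I%:C%C + d%:C%C :> R[i] by rewrite rmorphD.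
    by rewrite /y Id; lmod_in R[i] V.
  rewrite yE in h1; have := nmB y (d%:C%C *: w'); rewrite nmZr gtr0_norm // => h2.
  have h3 : C * nm (y - d%:C%C *: w') <= C * (nm y + d * nm w').
    by rewrite ler_pM2l.
  have h4 : C * (nm y + d * nm w') = C * nm y + 8^-1 * nm w'.
    by rewrite mulrDr mulrA (mulrC C d) dC.
  have := nm_ge0 w'; lra.
have PId : resolvent_invariant (I + d).
  apply: contrapT => nP; have : I + d <= I.
    by apply: ub_le_sup; [exists (2 * a + 1)|split=> //; lra].
  lra.
have [s [s1 nPs] Is] := sup_adherent d0 sup_bad.
have sI : s <= I by apply: ub_le_sup; [exists (2 * a + 1)|split].
apply: nPs; apply: resolvent_invariant_near hC2 _ PId.
- lra.
- lra.
rewrite ger0_norm; last by lra.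
have : (I + d - s) * (2 * C) <= (2 * d) * (2 * C).
  by rewrite ler_pM2r; rewrite ?mulr_gt0 //; rewrite -/I in Is; lra.
lra.
Qed.

End invariant_subspaces.

(** * Products in the closed subtriple generated by one element *)

Section functional_calculus.
Variables (R : realType) (E : jbTriple R) (x : E).
Implicit Types (a b c u v w z : E) (k l mu : R[i]).

Local Notation L := (fun z => <|x, x, z|>).

Lemma box_linear : linear (fun z => <|x, x, z|>).
Proof. by move=> k u v; rewrite tpDr tpZr. Qed.

Let Llin : {linear E -> E} :=
  HB.pack_for {linear E -> E} (fun z : E => <|x, x, z|>)
    (GRing.isLinear.Build _ _ _ _ (fun z : E => <|x, x, z|>) box_linear).

Lemma box_bounded : exists2 C, 0 < C & forall z, nm <|x, x, z|> <= C * nm z.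
Proof.
have [K K0 hK] := tp_bounded E; exists (K * nm x * nm x + 1).
  by rewrite ltr_wpDl // !mulr_ge0 ?nm_ge0 // ltW.
by move=> z; rewrite (le_trans (hK _ _ _)) // ler_wpM2r ?nm_ge0 ?lerDl.
Qed.

Lemma box_resolvent l : ~~ (0 <= l) -> exists S : E -> E, [/\
  exists2 C, 0 < C & forall z, nm (S z) <= C * nm z,
  forall z, S (<|x, x, z|> - l *: z) = z,
  forall z, <|x, x, S z|> - l *: S z = z & linear S].
Proof.
move=> /negP l0.
have : ~ op_spectrum (triple x x) l.
  by move=> lS; apply: l0; apply: (tp_spectrum (jb_axioms E) lS).
move=> /contrapT[S [Sc SK KS]]; exists S.
have Slin : linear S.
  move=> k u v; rewrite -[RHS]SK; congr S.
  rewrite tpDr tpZr.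
  apply: (@eq_lincomb2 _ _ (- k) (- 1) _ _ _ _ _ _ (KS u) (KS v)).
  by lmod_in R[i] E.
split=> //; apply: linear_continuous_bounded; last exact: Sc.
move=> k u; have := Slin k u 0; rewrite !addr0 => ->.
have -> : S 0 = 0; last by rewrite addr0.
by rewrite -[RHS](SK 0) tp0 scaler0 subrr.
Qed.

Local Notation pow n := (iter n (fun z => <|x, x, z|>) x).

(** [pow n] is the odd power [x^(2 n + 1)]. Strong induction on the total degree: [tp_JP1] settles
    [i = 0], and the Jordan identity for [L(x,x)] raises [i]. *)
Lemma power_associative (i j k : nat) :
  <|pow i, pow j, pow k|> = pow (i + j + k).+1.
Proof.
have [n] := ubnP (i + j + k); elim: n i j k => // n IH i j k ijk.
have top (m : nat) : (m <= n)%N -> <|x, pow m, x|> = pow m.+1.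
  case: m => [//|m] mn.
  have h (b c : nat) : (b + c = m)%N -> <|x, pow b, pow c.+1|> = <|x, pow m.+1, x|>.
    move=> bc; have cm : (c <= m)%N by rewrite -bc leq_addl.
    have -> : pow c.+1 = <|x, pow c, x|>.
      by rewrite (IH 0%N c 0%N) ?addn0 // (leq_ltn_trans cm).
    by rewrite tp_JP1 (IH b 0%N c) ?addn0 bc.
  by rewrite -(h 0%N m).
elim: i j k ijk => [|i IHi] j k ijk.
  case: k ijk => [|k] ijk; first by rewrite addn0; apply: top; rewrite addn0 in ijk.
  rewrite add0n addnS in ijk *.
  have -> : pow k.+1 = <|x, pow k, x|>.
    by rewrite (IH 0%N k 0%N) ?addn0 // (leq_ltn_trans (leq_addl j k)).
  by rewrite tp_JP1 (IH j 0%N k) ?addn0 //; apply: top.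
have := tp_jordanE x x (pow i) (pow j) (pow k); rewrite (IH i j k) //.
rewrite -!iterS (IHi j.+1 k) ?(IHi j k.+1) ?addnS ?addSn //.
move=> h; apply: (@eq_lincomb1 _ _ (- 1) _ _ _ _ h).
rewrite /=; lmod_in R[i] E.
Qed.

(* The triple product, on the closed subtriple generated by [x], is linear
   over the polynomials in L(x,x). *)
Definition balanced a b c := forall m n p,
  <|iter m L a, iter n L b, iter p L c|> = iter (m + n + p) L <|a, b, c|>.

Lemma balanced_gen : balanced x x x.
Proof.
move=> m n p; rewrite power_associative.
by rewrite -[<|x, x, x|>]/(iter 1 L x) -iterD addn1.
Qed.

Lemma balancedC a b c : balanced a b c -> balanced c b a.
Proof.
by move=> h m n p; rewrite tpC h (tpC c) -addnA addnC (addnC n).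
Qed.

Let iterLD n u v : iter n L (u + v) = iter n L u + iter n L v.
Proof. by elim: n => //= n ->; rewrite tpDr. Qed.

Let iterLZ n k u : iter n L (k *: u) = k *: iter n L u.
Proof. by elim: n => //= n ->; rewrite tpZr. Qed.

Let iterL_bounded n : exists2 C, 0 < C & forall z, nm (iter n L z) <= C * nm z.
Proof.
have [C C0 hC] := box_bounded; exists (C ^+ n); first exact: exprn_gt0.
elim: n => [|n IH] z /=; first by rewrite mul1r.
by rewrite (le_trans (hC _)) // exprS -mulrA ler_pM2l.
Qed.

Lemma closed_eq_bounded (f g : E -> E) (C : R) :
  (forall u v, f (u + v) = f u + f v) -> (forall u v, g (u + v) = g u + g v) ->
  (forall u, nm (f u) <= C * nm u) -> (forall u, nm (g u) <= C * nm u) ->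
  forall u, (forall e : R, 0 < e -> exists2 w, f w = g w & nm (u - w) < e) ->
  f u = g u.
Proof.
move=> fD gD fC gC u h; apply/eqP; rewrite -subr_eq0 -nm_eq0.
rewrite eq_le nm_ge0 andbT; apply/ler_addgt0Pr => e e0; rewrite add0r.
pose K := 2 * `|C| + 1.
have K0 : 0 < K by rewrite ltr_wpDl // mulr_ge0.
have [w fgw uw] := h (e / K) (divr_gt0 e0 K0).
have -> : f u - g u = f (u - w) - g (u - w).
  have -> : f u = f (u - w) + f w by rewrite -fD subrK.
  have -> : g u = g (u - w) + g w by rewrite -gD subrK.
  by rewrite fgw; lmod_in R[i] E.
apply: (le_trans (nmB _ _)); apply: (le_trans (lerD (fC _) (gC _))).
have h1 : C * nm (u - w) <= `|C| * nm (u - w).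
  by rewrite ler_wpM2r ?nm_ge0 ?ler_norm.
have h2 : K * nm (u - w) <= e by rewrite mulrC -ler_pdivlMr // ltW.
have h3 : K * nm (u - w) = 2 * (`|C| * nm (u - w)) + nm (u - w).
  by rewrite /K; ring.
have := nm_ge0 (u - w); lra.
Qed.

Lemma balanced_closed b c : closed_subspace (fun a => balanced a b c).
Proof.
split=> [u v hu hv|k u hu|u hu] m n p.
- by rewrite iterLD !tpD hu hv iterLD.
- by rewrite iterLZ !tpZl hu iterLZ.
have [K K0 hK] := tp_bounded E.
have [Cm Cm0 hm] := iterL_bounded m; have [Cs Cs0 hs] := iterL_bounded (m + n + p).
pose f z := <|iter m L z, iter n L b, iter p L c|>.
pose g z := iter (m + n + p) L <|z, b, c|>.
pose D := Num.max (K * Cm * nm (iter n L b) * nm (iter p L c)) (Cs * K * nm b * nm c).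
apply: (@closed_eq_bounded f g D).
- by move=> z z'; rewrite /f iterLD tpD.
- by move=> z z'; rewrite /g tpD iterLD.
- move=> z; rewrite /f (le_trans (hK _ _ _)) //.
  apply: (@le_trans _ _ (K * Cm * nm (iter n L b) * nm (iter p L c) * nm z)).
    have -> : K * Cm * nm (iter n L b) * nm (iter p L c) * nm z =
      K * (Cm * nm z) * nm (iter n L b) * nm (iter p L c) by ring.
    by rewrite !ler_wpM2r ?nm_ge0 // ler_pM2l.
  by rewrite ler_wpM2r ?nm_ge0 // le_max lexx.
- move=> z; rewrite /g (le_trans (hs _)) //.
  apply: (@le_trans _ _ (Cs * K * nm b * nm c * nm z)).
    have -> : Cs * K * nm b * nm c * nm z = Cs * (K * nm z * nm b * nm c) by ring.
    by rewrite ler_pM2l.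
  by rewrite ler_wpM2r ?nm_ge0 // le_max lexx orbT.
- by move=> e e0; have [w hw uw] := hu e e0; exists w => //; exact: hw.
Qed.

Lemma balanced_closed_mid a c : closed_subspace (fun b => balanced a b c).
Proof.
split=> [u v hu hv|k u hu|u hu] m n p.
- by rewrite iterLD !tpD hu hv iterLD.
- by rewrite iterLZ !tpZm hu iterLZ.
have [K K0 hK] := tp_bounded E.
have [Cm Cm0 hm] := iterL_bounded n; have [Cs Cs0 hs] := iterL_bounded (m + n + p).
pose f z := <|iter m L a, iter n L z, iter p L c|>.
pose g z := iter (m + n + p) L <|a, z, c|>.
pose D := Num.max (K * Cm * nm (iter m L a) * nm (iter p L c)) (Cs * K * nm a * nm c).
apply: (@closed_eq_bounded f g D).
- by move=> z z'; rewrite /f iterLD tpD.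
- by move=> z z'; rewrite /g tpD iterLD.
- move=> z; rewrite /f (le_trans (hK _ _ _)) //.
  apply: (@le_trans _ _ (K * Cm * nm (iter m L a) * nm (iter p L c) * nm z)).
    have -> : K * Cm * nm (iter m L a) * nm (iter p L c) * nm z =
      K * nm (iter m L a) * (Cm * nm z) * nm (iter p L c) by ring.
    by rewrite ler_wpM2r ?nm_ge0 // ler_wpM2l // mulr_ge0 ?nm_ge0 // ltW.
  by rewrite ler_wpM2r ?nm_ge0 // le_max lexx.
- move=> z; rewrite /g (le_trans (hs _)) //.
  apply: (@le_trans _ _ (Cs * K * nm a * nm c * nm z)).
    have -> : Cs * K * nm a * nm c * nm z = Cs * (K * nm a * nm z * nm c) by ring.
    by rewrite ler_pM2l.
  by rewrite ler_wpM2r ?nm_ge0 // le_max lexx orbT.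
- by move=> e e0; have [w hw uw] := hu e e0; exists w => //; exact: hw.
Qed.

Lemma balancedL a b c : balanced a b c -> balanced <|x, x, a|> b c.
Proof.
move=> h m n p; have -> : <|<|x, x, a|>, b, c|> = iter 1 L <|a, b, c|>.
  exact: h 1%N 0%N 0%N.
rewrite -[<|x, x, a|>]/(iter 1 L a) -iterD h -[RHS]iterD.
by congr (iter _ _ _); rewrite !addn1 !addSn.
Qed.

Lemma balancedM a b c : balanced a b c -> balanced a <|x, x, b|> c.
Proof.
move=> h m n p; have -> : <|a, <|x, x, b|>, c|> = iter 1 L <|a, b, c|>.
  exact: h 0%N 1%N 0%N.
rewrite -[<|x, x, b|>]/(iter 1 L b) -iterD h -[RHS]iterD.
by congr (iter _ _ _); rewrite !addn1 addnS addSn.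
Qed.

Lemma box_invariant_resolvent (W : E -> Prop) w : closed_subspace W ->
  (forall u, W u -> W <|x, x, u|>) -> W (<|x, x, w|> + w) -> W w.
Proof.
move=> Wc WL; have [a a0 ha] := box_bounded.
apply: (@invariant_resolvent _ _ Llin W Wc WL a (ltW a0) ha) => s s0.
have [|S [[C C0 hC] SK KS _]] := @box_resolvent (- s%:C%C).
  by rewrite oppr_ge0 lecE /= negb_and -ltNge s0 orbT.
exists C => //; split=> [z|v].
  have := SK z; rewrite scaleNr opprK => SKz.
  by have := hC (<|x, x, z|> + s%:C%C *: z); rewrite SKz.
by exists (S v); have := KS v; rewrite scaleNr opprK.
Qed.

End functional_calculus.

(** * Two rational functions of an element of the unit ball *)

Section midpoint.
Variables (R : realType) (E : jbTriple R) (x : E).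
Implicit Types (a b c u v w z : E) (l mu : R[i]) (i j k n : nat).

Local Notation L := (fun z => <|x, x, z|>).

(** This is [(3^n - 1) / 2]: the odd power of exponent [2 m + 1] at this [m] is the n-fold iterated
    cube. *)
Definition cube_index n : nat := iter n (fun k => 3 * k + 1)%N 0%N.

Lemma nm_cube_iter (f : nat -> E) n :
  (forall k, <|f k, f k, f k|> = f (3 * k + 1)%N) ->
  nm (f (cube_index n)) = nm (f 0%N) ^+ (3 ^ n).
Proof.
move=> f3; elim: n => [|n IH] /=; first by rewrite expr1.
by rewrite -f3 nm_cube IH -exprM expnSr.
Qed.

Lemma cube_indexE n : (2 * cube_index n + 1 = 3 ^ n)%N.
Proof.
by elim: n => //= n IH; rewrite expnS -IH; ring.
Qed.

Lemma cube_index_ge n : (n <= cube_index n)%N.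
Proof.
elim: n => //= n IH; rewrite addn1 ltnS (leq_trans IH) //.
by rewrite leq_pmull.
Qed.

Lemma add_box_inj z : <|x, x, z|> + z = 0 -> z = 0.
Proof.
have [|S [_ SK _ _]] := box_resolvent x (l := - 1); first by rewrite oppr_ge0 ler10.
move=> z0; have := SK z; rewrite scaleN1r opprK z0 => <-.
by rewrite -[RHS](SK 0) tp0 scaler0 subrr.
Qed.

Section resolvent.
Variables (S : E -> E) (CS : R).
Hypotheses (S_bound : forall z, nm (S z) <= CS * nm z) (CS_gt0 : 0 < CS).
Hypothesis SK : forall z, S (<|x, x, z|> + z) = z.
Hypothesis KS : forall z, <|x, x, S z|> + S z = z.
Hypothesis S_linear : linear S.

Let SD u v : S (u + v) = S u + S v.
Proof. by have := S_linear 1 u v; rewrite !scale1r. Qed.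

Let SZ l u : S (l *: u) = l *: S u.
Proof.
have S0 : S 0 = 0 by apply: (@addrI _ (S 0)); rewrite -SD !addr0.
by have := S_linear l u 0; rewrite S0 !addr0.
Qed.

Let LS z : <|x, x, S z|> = S <|x, x, z|>.
Proof.
apply: (@addIr _ (S z)); rewrite KS -SD; exact/esym/SK.
Qed.

Let iterLS m n z : iter m L (iter n S z) = iter n S (iter m L z).
Proof.
have LiterS u : <|x, x, iter n S u|> = iter n S <|x, x, u|>.
  by elim: n => //= n IH; rewrite LS IH.
by elim: m => //= m ->; rewrite LiterS.
Qed.

Let iterLZ n l u : iter n L (l *: u) = l *: iter n L u.
Proof. by elim: n => //= n ->; rewrite tpZr. Qed.

(** The balanced [a] form a closed subspace invariant under [L(x,x)], hence under its resolvent at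
    -1. Then [X = {S a, b, c}] solves [L X + X = {a, b, c}]. *)
Lemma balanced_resolvent a b c : balanced x a b c ->
  balanced x (S a) b c /\ <|S a, b, c|> = S <|a, b, c|>.
Proof.
move=> abc.
have Sabc : balanced x (S a) b c.
  apply: (@box_invariant_resolvent _ _ x (fun z => balanced x z b c)).
  - exact: balanced_closed.
  - by move=> u; exact: balancedL.
  - by rewrite KS.
split=> //; rewrite -{2}(KS a) tpDl.
have := Sabc 1%N 0%N 0%N => /= ->.
by rewrite SK.
Qed.

Lemma balanced_resolvent_mid a b c : balanced x a b c ->
  balanced x a (S b) c /\ <|a, S b, c|> = S <|a, b, c|>.
Proof.
move=> abc.
have Sabc : balanced x a (S b) c.
  apply: (@box_invariant_resolvent _ _ x (fun z => balanced x a z c)).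
  - exact: balanced_closed_mid.
  - by move=> u; exact: balancedM.
  - by rewrite KS.
split=> //; rewrite -{2}(KS b) tpDm.
have := Sabc 0%N 1%N 0%N => /= ->.
by rewrite SK.
Qed.

Local Notation z n := (iter n S x).

Lemma balanced_iter_resolvent i j k : balanced x (z i) (z j) (z k) /\
  <|z i, z j, z k|> = iter (i + j + k) S <|x, x, x|>.
Proof.
elim: i => [|i [bi IHi]] /=; last first.
  by have [h1 h2] := balanced_resolvent bi; split=> //; rewrite h2 IHi.
elim: j => [|j [bj IHj]] /=; last first.
  by have [h1 h2] := balanced_resolvent_mid bj; split=> //; rewrite h2 IHj.
elim: k => [|k [bk IHk]] /=; first by split=> //; exact: balanced_gen.
have [h1 h2] := balanced_resolvent (balancedC bk).
by split; [exact: balancedC|rewrite tpC h2 tpC IHk].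
Qed.

(** In the commutative model [Y k] is the power [2 k + 1] of [2 t / (1 + t^2)]; [c k] is the factor
    [2^(2 k + 1)]. *)
Let w k := iter k L (z (2 * k + 1)).
Let c k : R[i] := (4 ^ k * 2)%:R.
Let Y k := c k *: w k.

Let w_cube k m : <|iter m L (w k), iter m L (w k), iter m L (w k)|> =
  iter (3 * m) L (w (3 * k + 1)).
Proof.
have [bal tri] := balanced_iter_resolvent (2 * k + 1) (2 * k + 1) (2 * k + 1).
rewrite /w -!iterD bal tri.
rewrite -[<|x, x, x|>]/(iter 1 L x) -(iterLS 1) -!iterD.
congr (iter _ _ (iter _ _ _)).
  by rewrite !mulSn mul0n; ring.
by ring.
Qed.

Let conj_c k : Num.conj (c k) = c k. Proof. exact: rmorph_nat. Qed.

Let c_cube k : c k * (c k * c k) = c (3 * k + 1)%N.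
Proof.
by rewrite /c -!natrM; congr (_%:R); rewrite expnD expn1 (mulnC 3%N) expnM; ring.
Qed.

Let Y_cube m k : <|iter m L (Y k), iter m L (Y k), iter m L (Y k)|> =
  iter (3 * m) L (Y (3 * k + 1)).
Proof.
rewrite /Y !iterLZ tpZl tpZm tpZr conj_c w_cube !scalerA; congr (_ *: _).
by rewrite -c_cube mulrA.
Qed.

Let A v := 4%:R *: <|x, x, S (S v)|>.

Let A_linear : linear A.
Proof.
move=> l u v; rewrite /A !(SD, SZ) tpDr tpZr scalerDr !scalerA.
by rewrite (mulrC l).
Qed.

Let Alin : {linear E -> E} :=
  HB.pack_for {linear E -> E} A (GRing.isLinear.Build _ _ _ _ A A_linear).

Let iterA k : iter k A (Y 0%N) = Y k.
Proof.
elim: k => //= k ->; rewrite /A /Y !SZ tpZr scalerA; congr (_ *: _).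
  by rewrite /c -natrM expnS mulnA.
rewrite /w -[S (S _)]/(iter 2 S _) -iterLS -iterD.
by rewrite -[<|x, x, _|>]/(iter 1 L _) -iterD mulnS -addnA.
Qed.

(* [A = 4 L (1 + L)^-2], and [1 - mu A = (L - l1) (L - l2) (1 + L)^-2] where
   [l1 l2 = 1] and [mu = (1 + l1)^2 / (4 l1)]. *)
Let A_resolvent mu : complex.Re `|mu| < 1 ->
  exists G : E -> E, exists C : R, [/\ 0 < C,
    forall u, nm (G u) <= C * nm u, forall u, G (u - mu *: A u) = u
    & forall u, G u - mu *: A (G u) = u].
Proof.
move=> mu1.
pose D := sqrtC ((2%:R * mu - 1) ^+ 2 - 1).
pose l1 := 2%:R * mu - 1 + D; pose l2 := 2%:R * mu - 1 - D.
have D2 : D ^+ 2 = (2%:R * mu - 1) ^+ 2 - 1 by exact: sqrtCK.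
have l12 : l1 * l2 = 1.
  have -> : l1 * l2 = (2%:R * mu - 1) ^+ 2 - D ^+ 2 by rewrite /l1 /l2; ring.
  by rewrite D2; ring.
have sl : l1 + l2 = 4%:R * mu - 2%:R by rewrite /l1 /l2; ring.
(* A root [l >= 0] would give [mu = (1 + l)^2 / (4 l) >= 1]. *)
have notpos l l' : l * l' = 1 -> l + l' = 4%:R * mu - 2%:R -> ~~ (0 <= l).
  move=> ll' sll; apply/negP => l_ge0.
  have l0 : l != 0.
    by apply/eqP => l0; move: ll'; rewrite l0 mul0r => /esym/eqP; rewrite oner_eq0.
  have lgt0 : 0 < l by rewrite lt_def l0.
  have muE : mu = (l - 1) ^+ 2 / (4%:R * l) + 1.
    have -> : mu = (l + l' + 2%:R) / 4%:R by rewrite sll; field.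
    have -> : l' = l^-1 by rewrite -[RHS]mulr1 -ll' mulKf.
    by field.
  have h1 : 1 <= mu.
    rewrite muE lerDr; apply: divr_ge0; last exact: mulr_ge0.
    by rewrite real_exprn_even_ge0 // rpredB ?rpred1 // ger0_real.
  have : 1 <= `|mu| by rewrite ger0_norm // (le_trans ler01).
  by rewrite lecE /= leNgt mu1 andbF.
have [S1 [[C1 C10 hC1] SK1 KS1 _]] := box_resolvent x (notpos _ _ l12 sl).
have [S2 [[C2 C20 hC2] SK2 KS2 _]] : exists S2 : E -> E, [/\
    exists2 C, 0 < C & forall z, nm (S2 z) <= C * nm z,
    forall z, S2 (<|x, x, z|> - l2 *: z) = z,
    forall z, <|x, x, S2 z|> - l2 *: S2 z = z & linear S2].
  by apply: box_resolvent; apply: (notpos l2 l1); [rewrite mulrC|rewrite addrC].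
have [CL CL0 hCL] := box_bounded x.
pose P u := <|x, x, u|> + u.
have hP u : nm (P u) <= (CL + 1) * nm u.
  by rewrite (le_trans (nmD _ _)) // mulrDl mul1r lerD2r.
have quad u : P (P u) - (mu * 4%:R) *: <|x, x, u|> =
    <|x, x, <|x, x, u|> - l2 *: u|> - l1 *: (<|x, x, u|> - l2 *: u).
  have e1 : mu * 4%:R = l1 + l2 + 2%:R by rewrite sl; ring.
  rewrite e1 /P !tpDr tpN tpZr scalerBr scalerA l12; lmod_in R[i] E.
have SPP u : S (S (P (P u))) = u by rewrite !SK.
have PPS u : P (P (S (S u))) = u by rewrite /P !KS.
have LSS u : <|x, x, S (S u)|> = S (S <|x, x, u|>) by rewrite !LS.
pose G u := P (P (S2 (S1 u))).
exists G, ((CL + 1) * ((CL + 1) * (C2 * C1))); split.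
- by rewrite !mulr_gt0 // ltr_wpDl // ltW.
- have CL1 : 0 < CL + 1 by rewrite ltr_wpDl // ltW.
  move=> u; rewrite /G (le_trans (hP _)) // -mulrA ler_pM2l //.
  rewrite (le_trans (hP _)) // -mulrA ler_pM2l // (le_trans (hC2 _)) //.
  by rewrite -mulrA ler_pM2l.
- move=> u; rewrite /G; have -> : u - mu *: A u =
      P (P (S (S u))) - (mu * 4%:R) *: <|x, x, S (S u)|>.
    by rewrite PPS /A scalerA.
  by rewrite quad SK1 SK2 PPS.
- move=> u; rewrite /G /A LSS; set t := S2 (S1 u).
  have -> : S (S <|x, x, P (P t)|>) = <|x, x, t|>.
    by rewrite -LSS SPP.
  by rewrite scalerA quad KS2 KS1.
Qed.

Let ler_contra_pow (p q C : R) (f : nat -> nat) : (forall n, n <= f n)%N ->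
  1 < p -> (forall n, p ^+ (f n) <= C) -> False.
Proof.
move=> fn p1 hC.
have p0 : 0 < p by rewrite (lt_trans ltr01).
have pinv : `|p^-1| < 1 by rewrite gtr0_norm ?invr_gt0 // invf_lt1.
have /cvgrPdist_lt /(_ (`|C| + 1)^-1) : (fun n => p^-1 ^+ n) @ \oo --> (0 : R).
  exact: cvg_expr.
have C1 : 0 < `|C| + 1 by rewrite ltr_wpDl.
rewrite invr_gt0 => /(_ C1)[N _ /(_ N (leqnn N))] /=.
rewrite sub0r normrN ger0_norm ?exprn_ge0 ?invr_ge0 ?(ltW p0) // exprVn.
rewrite ltf_pV2 ?posrE ?exprn_gt0 // => h.
have h1 : p ^+ N <= p ^+ f N by rewrite ler_weXn2l // ltW.
have := hC N; have := ler_norm C; lra.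
Qed.

(** Suppose [q = nm (Y 0) > 1]. For [m = cube_index n], [A^m (Y 0) = Y m] has norm
    [q^(3^n) = q^(2 m + 1)], whereas the growth bound at [s = 1 / q] allows only [C q^(m + 1)]. *)
Lemma nm_cayley : nm (2%:R *: S x) <= 1.
Proof.
have Y0 : Y 0%N = 2%:R *: S x by rewrite /Y /c /w expn0 mul1n.
rewrite -Y0 leNgt; apply/negP => y1.
set q := nm (Y 0%N) in y1.
have q0 : 0 < q by rewrite (lt_trans ltr01).
have [CL CL0 hCL] := box_bounded x.
have A_bound v : nm (Alin v) <= (4%:R * (CL * (CS * CS))) * nm v.
  rewrite /= /A nmZ normr_nat -(rmorph_nat (real_complex R)) /=.
  rewrite -[leRHS]mulrA ler_pM2l // (le_trans (hCL _)) // -mulrA ler_pM2l //.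
  by rewrite (le_trans (S_bound _)) // -mulrA ler_pM2l.
have a0 : 0 <= 4%:R * (CL * (CS * CS)) by rewrite !mulr_ge0 // ltW.
have [|C C0 hC] := @power_growth _ _ Alin _ a0 A_bound A_resolvent q^-1.
  by rewrite invr_gt0 q0 invf_lt1.
have hY n : q ^+ cube_index n <= C.
  have := hC (cube_index n) (Y 0%N); rewrite [iter _ _ _]iterA.
  rewrite (nm_cube_iter n (f := Y)) -/q; last by move=> k; exact: (Y_cube 0).
  rewrite -cube_indexE mulnC muln2 -addnn -addnA exprD mulrA -exprMn.
  rewrite mulVf ?gt_eqF // expr1n mul1r exprD expr1.
  by rewrite ler_pM2r.
exact: (ler_contra_pow q cube_index_ge y1 hY).
Qed.

(** [B k] models the power [2 k + 1] of [2 t^3 / (1 + t^2)]. At cube indices its norm is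
    [nm (B 0)^(3^n)], while [B k = {L^k x, L^k x, Y k}] stays below the bound [K] of the triple
    product; so [nm (B 0) <= 1]. *)
Lemma nm_box_cayley : nm x <= 1 -> nm <|x, x, 2%:R *: S x|> <= 1.
Proof.
move=> x1; have y1 := nm_cayley.
have Y0 : Y 0%N = 2%:R *: S x by rewrite /Y /c /w expn0 mul1n.
rewrite -Y0 in y1 *; rewrite leNgt; apply/negP => b1.
pose B k := iter (2 * k + 1) L (Y k).
have B0 : B 0%N = <|x, x, Y 0%N|> by [].
have B_cube k : <|B k, B k, B k|> = B (3 * k + 1)%N.
  rewrite /B Y_cube.
  by have -> : (3 * (2 * k + 1) = 2 * (3 * k + 1) + 1)%N by ring.
have BE k : B k = <|iter k L x, iter k L x, Y k|>.
  have [bal _] := balanced_iter_resolvent 0 0 (2 * k + 1).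
  rewrite /B /Y /w iterLZ tpZr bal; congr (_ *: _).
  rewrite -[<|z 0, z 0, _|>]/(iter 1 L _) -!iterD.
  by have -> : (2 * k + 1 + k = k + k + k + 1)%N by ring.
have [K K0 hK] := tp_bounded E.
rewrite -B0 in b1.
have id_ge n : (n <= 3 ^ n)%N by rewrite ltnW // ltn_expl.
apply: (ler_contra_pow (nm (B 0%N)) (C := K) id_ge b1) => n.
rewrite -nm_cube_iter // BE (le_trans (hK _ _ _)) //.
have h1 : nm (iter (cube_index n) L x) <= 1.
  rewrite (nm_cube_iter n (f := fun k => iter k L x)) /=; last first.
    move=> k; rewrite power_associative -addn1.
    by have -> : (k + k + k + 1 = 3 * k + 1)%N by ring.
  by rewrite exprn_ile1 ?nm_ge0.
have h2 : nm (Y (cube_index n)) <= 1.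
  rewrite (nm_cube_iter n (f := Y)); last by move=> k; exact: (Y_cube 0).
  by rewrite exprn_ile1 ?nm_ge0.
rewrite -!mulrA ger_pMr // mulr_ile1 ?mulr_ge0 ?nm_ge0 //.
by rewrite mulr_ile1 ?nm_ge0.
Qed.

End resolvent.

(* In the commutative model [a] and [<|x, x, a|>] are the functions
   [2 t / (1 + t^2)] and [2 t^3 / (1 + t^2)]. *)
Lemma ball_midpoint : nm x <= 1 -> exists a,
  [/\ <|x, x, a|> + a = 2%:R *: x, nm a <= 1 & nm <|x, x, a|> <= 1].
Proof.
move=> x1; have [|S [[C C0 hC] SK KS Slin]] := box_resolvent x (l := - 1).
  by rewrite oppr_ge0 ler10.
have SK' z : S (<|x, x, z|> + z) = z by have := SK z; rewrite scaleN1r opprK.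
have KS' z : <|x, x, S z|> + S z = z by have := KS z; rewrite scaleN1r opprK.
exists (2%:R *: S x); split.
- by rewrite tpZr -scalerDr KS'.
- exact: nm_cayley hC C0 SK' KS' Slin.
- exact: nm_box_cayley hC C0 SK' KS' Slin x1.
Qed.

End midpoint.

(** * Extreme linear minorants *)

Section extreme_functionals.
Variables (R : realType) (P : lmodType R[i]).
Implicit Types (p q a : P) (s t r : R).

Definition real_linear (f : P -> R) : Prop :=
  (forall p q, f (p + q) = f p + f q) /\ (forall r p, f (r%:C%C *: p) = r * f p).

Definition sublinear (f : P -> R) : Prop :=
  (forall p q, f (p + q) <= f p + f q) /\
  (forall r p, 0 < r -> f (r%:C%C *: p) <= r * f p).

Lemma sublinear0 f : sublinear f -> f 0 = 0.
Proof.
move=> [fD fZ]; have h1 := fD 0 0; rewrite addr0 in h1.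
have := fZ 2^-1 0; rewrite scaler0 invr_gt0 ltr0n => /(_ isT); lra.
Qed.

Lemma sublinearZ f r p : sublinear f -> 0 <= r -> f (r%:C%C *: p) = r * f p.
Proof.
move=> fs; rewrite le_eqVlt => /predU1P[<-|r0].
  by rewrite scale0r mul0r sublinear0.
have [_ fZ] := fs; apply/le_anti; rewrite fZ //=.
have rV0 : 0 < r^-1 by rewrite invr_gt0.
have := fZ r^-1 (r%:C%C *: p) rV0; rewrite scalerA -rmorphM mulVf ?gt_eqF //.
by rewrite rmorph1 scale1r ler_pdivlMl.
Qed.

Lemma sublinearN f p : sublinear f -> - f (- p) <= f p.
Proof.
move=> fs; have [fD _] := fs; have := fD p (- p).
rewrite subrr sublinear0 //; lra.
Qed.

(* The sublinear functional whose minorants are the minorants of [f] that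
   agree with [f] at [a]. *)
Definition tighten (f : P -> R) a p : R :=
  inf [set f (p + t%:C%C *: a) - t * f a | t in [set t : R | 0 <= t]].

Section tighten.
Variables (f : P -> R) (a : P).
Hypothesis f_sub : sublinear f.

Let lb p t : 0 <= t -> - f (- p) <= f (p + t%:C%C *: a) - t * f a.
Proof.
move=> t0; rewrite -(sublinearZ a f_sub t0); have [fD _] := f_sub.
have := fD (p + t%:C%C *: a) (- p).
by rewrite (addrC p) addrK; lra.
Qed.

Lemma tighten_le p t : 0 <= t -> tighten f a p <= f (p + t%:C%C *: a) - t * f a.
Proof.
move=> t0; apply: inf_lbound; last by exists t.
by exists (- f (- p)) => _ [s s0 <-]; exact: lb.
Qed.

Lemma le_tighten p r :
  (forall t, 0 <= t -> r <= f (p + t%:C%C *: a) - t * f a) -> r <= tighten f a p.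
Proof.
move=> h; apply: lb_le_inf; last by move=> _ [t t0 <-]; exact: h.
by exists (f (p + 0%:C%C *: a) - 0 * f a); exists 0 => /=.
Qed.

Lemma tighten_minorant p : tighten f a p <= f p.
Proof.
by have := tighten_le p (lexx 0); rewrite scale0r addr0 mul0r subr0.
Qed.

Lemma tightenN : tighten f a (- a) <= - f a.
Proof.
have := tighten_le (- a) ler01.
by rewrite scale1r addNr sublinear0 // mul1r sub0r.
Qed.

Lemma tighten_sublinear : sublinear (tighten f a).
Proof.
have [fD fZ] := f_sub; split=> [p q|r p r0].
  rewrite -lerBlDr; apply: le_tighten => t t0.
  rewrite lerBlDr -lerBlDl; apply: le_tighten => s s0.
  rewrite lerBlDl (le_trans (tighten_le (p + q) (addr_ge0 t0 s0))) //.
  have := fD (p + t%:C%C *: a) (q + s%:C%C *: a).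
  rewrite addrACA -scalerDl rmorphD; lra.
rewrite -ler_pdivrMl //; apply: le_tighten => t t0.
rewrite ler_pdivrMl //.
apply: (le_trans (tighten_le (r%:C%C *: p) (mulr_ge0 (ltW r0) t0))).
rewrite mulrBr mulrA lerD2r rmorphM -scalerA -scalerDr; exact: fZ.
Qed.

End tighten.

(* Minimal sublinear functionals are linear; keeping track of the extremality
   of the set of minorants gives both the Hahn-Banach theorem and the
   Krein-Milman theorem for the set of linear minorants of [rho]. *)
Lemma extreme_minorant (rho : P -> R) p0 : sublinear rho -> exists f : P -> R,
  [/\ real_linear f, forall p, f p <= rho p, f p0 = rho p0
    & forall g h, real_linear g -> real_linear h ->
      (forall p, g p <= rho p) -> (forall p, h p <= rho p) ->
      (forall p, g p + h p = 2 * f p) -> forall p, g p = f p].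
Proof.
move=> rho_sub.
(* The linear minorants of [f] form a face of those of [rho]. The inequality, unlike an equality,
   makes sense for sublinear [f] and passes to [tighten] and to infima of chains; for linear [f] it
   is extremality. *)
pose face (f : P -> R) := forall g h, real_linear g -> real_linear h ->
  (forall p, g p <= rho p) -> (forall p, h p <= rho p) ->
  (forall p, g p + h p <= 2 * f p) -> forall p, g p <= f p.
pose good f := [/\ sublinear f, forall p, f p <= rho p, face f
  & f (- p0) <= - rho p0].
have tighten_face f a : sublinear f -> (forall p, f p <= rho p) -> face f ->
    face (tighten f a).
  move=> f_sub f_rho f_face g h gl hl g_rho h_rho gh.
  have ghf p : g p + h p <= 2 * f p.
    by have := gh p; have := tighten_minorant a f_sub p; lra.
  have hgf p : h p + g p <= 2 * f p by rewrite addrC.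
  have gf := f_face g h gl hl g_rho h_rho ghf.
  have hf := f_face h g hl gl h_rho g_rho hgf.
  have [gD gZ] := gl; have [hD hZ] := hl.
  have N1 : (- 1)%:C%C = - 1 :> R[i] by rewrite rmorphN rmorph1.
  have gN p : g (- p) = - g p by rewrite -scaleN1r -N1 gZ mulN1r.
  have hN p : h (- p) = - h p by rewrite -scaleN1r -N1 hZ mulN1r.
  (* At [- a] the hypothesis gives [g a + h a >= 2 f a], while each of the two values is at most
     [f a]. *)
  have ga : g a = f a.
    have := gh (- a); have := tightenN a f_sub; have := gf a; have := hf a.
    rewrite gN hN; lra.
  move=> p; apply: le_tighten => t t0.
  by have := gf (p + t%:C%C *: a); rewrite gD gZ ga; lra.
have tighten_good f a : good f -> good (tighten f a).
  move=> [fs fr ff fp]; split.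
  - exact: tighten_sublinear.
  - by move=> p; rewrite (le_trans (tighten_minorant a fs p)).
  - exact: tighten_face.
  - by rewrite (le_trans (tighten_minorant a fs _)).
have good0 : good (tighten rho p0).
  split.
  - exact: tighten_sublinear.
  - by move=> p; exact: tighten_minorant.
  - by apply: tighten_face => //; move=> g h _ _ g_rho h_rho gh.
  - exact: tightenN.
pose T := {f : P -> R | good f}.
(* The order is reversed: Zorn's maximal elements are the minimal functionals. *)
pose le (f g : T) : bool := `[< forall p, sval g p <= sval f p >].
have [||||f f_min] := @Zorn T le.
- by move=> f; apply/asboolP.
- move=> f g h /asboolP gf /asboolP hg; apply/asboolP => p.
  exact: le_trans (hg p) (gf p).
- move=> [f fg] [g gg] /asboolP /= gf /asboolP /= fg'.
  apply: eq_exist; apply/funext => p; apply/le_anti.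
  by rewrite gf fg'.
- move=> A chainA; have [[f0 Af0]|A0] := pselect (exists f, A f); last first.
    exists (exist _ _ good0) => g Ag; exfalso; apply: A0; by exists g.
  pose B p := [set sval f p | f in A].
  have B0 p : B p !=set0 by exists (sval f0 p); exists f0.
  have lbB p : has_lbound (B p).
    exists (- rho (- p)) => _ [[f fg] _ <-] /=; have [fs fr _ _] := fg.
    by have := sublinearN p fs; have := fr (- p); lra.
  pose m p := inf (B p).
  have m_le f p : A f -> m p <= sval f p.
    by move=> Af; apply: inf_lbound => //; exists f.
  have le_m p r : (forall f, A f -> r <= sval f p) -> r <= m p.
    by move=> h; apply: lb_le_inf => // _ [f Af <-]; exact: h.
  have m_good : good m.
    split.
    - split=> [p q|r p r0].
        rewrite -lerBlDr; apply: (le_m) => f Af; rewrite lerBlDr -lerBlDl.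
        apply: (le_m) => g Ag; rewrite lerBlDl.
        have [/asboolP gf|/asboolP fg] := chainA f g Af Ag.
          rewrite (le_trans (m_le g (p + q) Ag)) //.
          have [[gD _] _ _ _] := svalP g.
          by rewrite (le_trans (gD p q)) // lerD2r.
        rewrite (le_trans (m_le f (p + q) Af)) //.
        have [[fD _] _ _ _] := svalP f.
        by rewrite (le_trans (fD p q)) // lerD2l.
      rewrite -ler_pdivrMl //; apply: (le_m) => f Af; rewrite ler_pdivrMl //.
      rewrite (le_trans (m_le f _ Af)) //.
      by have [[_ fZ] _ _ _] := svalP f; exact: fZ.
    - move=> p; rewrite (le_trans (m_le f0 p Af0)) //.
      by have [_ fr _ _] := svalP f0.
    - move=> g h gl hl g_rho h_rho gh p; apply: (le_m) => f Af.
      have [_ _ ff _] := svalP f; apply: (ff g h) => // q.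
      by have := gh q; have := m_le f q Af; lra.
    - rewrite (le_trans (m_le f0 _ Af0)) //.
      by have [_ _ _ fp] := svalP f0.
  by exists (exist _ _ m_good) => f Af; apply/asboolP => p /=; exact: m_le.
case: f f_min => [f f_good] f_min; have [f_sub f_rho f_face fp0] := f_good.
(* By minimality [tighten f a] equals [f], which makes [f] odd; an odd sublinear functional is
   additive. *)
have fN a : f (- a) = - f a.
  apply/le_anti/andP; split; last first.
    by have := sublinearN a f_sub; lra.
  have /asboolP/f_min/(congr1 sval)/= E :
      forall p, sval (exist good _ (tighten_good f a f_good)) p <= f p.
    by move=> p /=; exact: tighten_minorant.
  by rewrite -{1}E; exact: tightenN.
have fD p q : f (p + q) = f p + f q.
  have [fle _] := f_sub; apply/le_anti/andP; split=> //.
  by have := fle (p + q) (- q); rewrite addrK fN; lra.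
have fl : real_linear f.
  split=> // r p; have [r0|r0] := leP 0 r; first exact: sublinearZ.
  have -> : r%:C%C = - (- r)%:C%C :> R[i] by rewrite rmorphN opprK.
  by rewrite scaleNr fN sublinearZ ?oppr_ge0 ?(ltW r0) // mulNr opprK.
exists f; split=> //.
  by apply/le_anti; rewrite f_rho /=; move: fp0; rewrite fN lerN2.
move=> g h gl hl g_rho h_rho gh p.
have gf q : g q <= f q.
  by apply: (f_face g h gl hl g_rho h_rho _ q) => r; rewrite gh.
apply/le_anti; rewrite gf /=; have := gf (- p).
have [_ gZ] := gl; have N1 : (- 1)%:C%C = - 1 :> R[i] by rewrite rmorphN rmorph1.
by rewrite -{1}scaleN1r -N1 gZ mulN1r fN lerN2.
Qed.

End extreme_functionals.

(** * The predual *)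

Section peirce_norm.
Variables (R : realType) (E : jbTriple R) (e : E).
Hypotheses (e3 : tripotent e) (e0 : e != 0).
Implicit Types (z : E).

Lemma tripotent_nm : nm e = 1.
Proof.
have ep : 0 < nm e by rewrite nm_gt0.
have : nm e = nm e ^+ 3 by rewrite -nm_cube e3.
nra.
Qed.

Let cubeE z : <|e, z, e|> = 0 -> <|e + z, e + z, e + z|> =
  e + 2%:R *: <|e, e, z|> + (2%:R *: <|e, z, z|> + <|z, e, z|> + <|z, z, z|>).
Proof.
move=> ez; rewrite !tpD e3 ez (tpC z e e) (tpC z z e).
lmod_in R[i] E.
Qed.

Let two_norm z : nm (2%:R *: z) = 2 * nm z.
Proof. by rewrite nmZ normr_nat -(rmorph_nat (real_complex R)). Qed.

Let cube_le (s d : R) : 0 <= s -> 0 <= d -> s ^+ 3 <= s + d -> s <= 1 + d.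
Proof. move=> s0 d0 h; rewrite leNgt; apply/negP => h1; nra. Qed.

(* Cubing [e + z] kills the Peirce-0 part of [z] and fixes the Peirce-1 part up
   to second order, so that [|e + z|^9 <= |e + z'| + O(|z|^2)] and
   [|e + z'|^3 <= |e + z'| + O(|z|^2)]. *)
Lemma nm_peirce_perturbation : exists2 C, 0 < C &
  forall z, <|e, z, e|> = 0 -> nm z <= 1 -> nm (e + z) <= 1 + C * nm z ^+ 2.
Proof.
have [K K0 hK] := tp_bounded E.
pose err z : E := 2%:R *: <|e, z, z|> + <|z, e, z|> + <|z, z, z|>.
have err_le z : nm (err z) <= 3 * K * nm z ^+ 2 + K * nm z ^+ 3.
  have h1 := hK e z z; have h2 := hK z e z; have h3 := hK z z z.
  rewrite tripotent_nm in h1 h2.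
  have := nmD (2%:R *: <|e, z, z|> + <|z, e, z|>) <|z, z, z|>.
  have := nmD (2%:R *: <|e, z, z|>) <|z, e, z|>; rewrite two_norm.
  rewrite -/(err z); have := nm_ge0 z; nra.
pose C1 := 12 * K ^+ 3 + 8 * K ^+ 4.
have C10 : 0 < C1 by rewrite /C1 addr_gt0 // mulr_gt0 // exprn_gt0.
exists (C1 + 4 * K); first by rewrite addr_gt0 // mulr_gt0.
move=> z ez z1; pose z' := 2%:R *: <|e, e, z|>.
have t0 := nm_ge0 z.
have z'_le : nm z' <= 2 * (K * nm z).
  by rewrite two_norm ler_pM2l //; have := hK e e z; rewrite tripotent_nm !mulr1.
have ez' : <|e, z', e|> = 0.
  by rewrite tpZm tripotent_QL // ez scaler0.
have z'E : 2%:R *: <|e, e, z'|> = z'.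
  have := tripotent_QQ e3 z; rewrite ez tp0 => h.
  rewrite /z' tpZr.
  by apply: (@eq_lincomb1 _ _ (- 2%:R) _ _ _ _ h); lmod_in R[i] E.
have s'_le : nm (e + z') <= 1 + C1 * nm z ^+ 2.
  apply: cube_le; first exact: nm_ge0.
    by rewrite mulr_ge0 ?sqr_ge0 // ltW.
  rewrite -nm_cube cubeE // z'E -/(err z').
  apply: (le_trans (nmD _ _)); rewrite lerD2l (le_trans (err_le z')) //.
  have t'0 := nm_ge0 z'.
  have h2 : nm z' ^+ 2 <= (2 * (K * nm z)) ^+ 2.
    by rewrite ler_sqr ?nnegrE // !mulr_ge0 // ltW.
  have h3 : nm z' ^+ 3 <= (2 * (K * nm z)) ^+ 3.
    by apply: lerXn2r; rewrite ?nnegrE // !mulr_ge0 // ltW.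
  have h4 : nm z ^+ 3 <= nm z ^+ 2 by rewrite exprS ler_piMl ?sqr_ge0.
  have h5 : 3 * K * nm z' ^+ 2 <= 3 * K * (2 * (K * nm z)) ^+ 2.
    by rewrite ler_pM2l // mulr_gt0.
  have h6 : K * nm z' ^+ 3 <= K * (2 * (K * nm z)) ^+ 3 by rewrite ler_pM2l.
  have h7 : 8 * K ^+ 4 * nm z ^+ 3 <= 8 * K ^+ 4 * nm z ^+ 2.
    by rewrite ler_pM2l // mulr_gt0 // exprn_gt0.
  apply: (le_trans (lerD h5 h6)).
  have -> : 3 * K * (2 * (K * nm z)) ^+ 2 + K * (2 * (K * nm z)) ^+ 3 =
    12 * K ^+ 3 * nm z ^+ 2 + 8 * K ^+ 4 * nm z ^+ 3 by ring.
  by rewrite /C1; move: h7; lra.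
have s_le : nm (e + z) ^+ 3 <= 1 + (C1 + 4 * K) * nm z ^+ 2.
  rewrite -nm_cube cubeE // -/z' -/(err z).
  apply: (le_trans (nmD _ _)); have := err_le z.
  have h4 : nm z ^+ 3 <= nm z ^+ 2 by rewrite exprS ler_piMl ?sqr_ge0.
  have h5 : K * nm z ^+ 3 <= K * nm z ^+ 2 by rewrite ler_pM2l.
  lra.
have d0 : 0 <= (C1 + 4 * K) * nm z ^+ 2.
  by rewrite mulr_ge0 ?sqr_ge0 // ltW // addr_gt0 // mulr_gt0.
have := nm_ge0 (e + z); move: s_le d0; set s := nm _; set d := _ * _ => h d0 s0.
rewrite leNgt; apply/negP => h1; nra.
Qed.

End peirce_norm.

(** * Real parts of the pairing and norming elements *)

Section duality.
Variables (R : realType) (E : jbwTriple R).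
Local Notation P := (predual E).
Local Notation pair := (@predual_pairing R E).
Implicit Types (x y z w e u : E) (p q : P) (k : R[i]).

Lemma pairDl x y p : pair (x + y) p = pair x p + pair y p.
Proof.
by have := pair_linearl (jbw_axioms E) p 1 x y; rewrite /= !scale1r.
Qed.

Lemma pair0l p : pair 0 p = 0.
Proof. by apply: (@addrI _ (pair 0 p)); rewrite -pairDl !addr0. Qed.

Lemma pairZl k x p : pair (k *: x) p = k * pair x p.
Proof.
by have := pair_linearl (jbw_axioms E) p k x 0; rewrite /= pair0l !addr0.
Qed.

Lemma pairDr x p q : pair x (p + q) = pair x p + pair x q.
Proof.
by have := pair_linearr (jbw_axioms E) x 1 p q; rewrite /= !scale1r.
Qed.

Lemma pair0r x : pair x 0 = 0.
Proof. by apply: (@addrI _ (pair x 0)); rewrite -pairDr !addr0. Qed.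

Lemma pairZr k x p : pair x (k *: p) = k * pair x p.
Proof.
by have := pair_linearr (jbw_axioms E) x k p 0; rewrite /= pair0r !addr0.
Qed.

Lemma pairNr x p : pair x (- p) = - pair x p.
Proof. by rewrite -scaleN1r pairZr mulN1r. Qed.

Lemma pairNl x p : pair (- x) p = - pair x p.
Proof. by rewrite -scaleN1r pairZl mulN1r. Qed.

Lemma cabs_pair_le x p : complex.Re `|pair x p| <= nm x * nm p.
Proof.
have := (pair_norm (jbw_axioms E) x (normr_ge0 x)).1 (lexx _) p.
rewrite (nmE x) (nmE p) -rmorphM.
have -> : `|pair x p| = (complex.Re `|pair x p|)%:C%C by rewrite RRe_real // normr_real.
by rewrite lecR.
Qed.

Lemma Re_le_cabs k : complex.Re k <= complex.Re `|k|.
Proof.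
apply: (le_trans (ler_norm _)); rewrite -lecR.
have -> : (complex.Re `|k|)%:C%C = `|k| by rewrite RRe_real // normr_real.
exact: normc_ge_Re.
Qed.

Lemma rotation k : exists2 om, complex.Re `|om| = 1 & om * k = (complex.Re `|k|)%:C%C.
Proof.
have kE : `|k| = (complex.Re `|k|)%:C%C by rewrite RRe_real // normr_real.
have [->|k0] := eqVneq k 0.
  by exists 1; rewrite ?normr1 ?mulr0 ?normr0.
exists (`|k| / k); last by rewrite -kE divfK.
by rewrite normrM normfV normr_id mulfV ?normr_eq0.
Qed.

Definition rpair x p : R := complex.Re (pair x p).

Lemma rpairDl x y p : rpair (x + y) p = rpair x p + rpair y p.
Proof. by rewrite /rpair pairDl raddfD. Qed.

Lemma rpairDr x p q : rpair x (p + q) = rpair x p + rpair x q.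
Proof. by rewrite /rpair pairDr raddfD. Qed.

Lemma rpairNl x p : rpair (- x) p = - rpair x p.
Proof. by rewrite /rpair pairNl raddfN. Qed.

Lemma rpairNr x p : rpair x (- p) = - rpair x p.
Proof. by rewrite /rpair pairNr raddfN. Qed.

Lemma Re_realM (r : R) k : complex.Re (r%:C%C * k) = r * complex.Re k.
Proof. by case: k => a b /=; rewrite mul0r subr0. Qed.

Lemma rpairZl (r : R) x p : rpair (r%:C%C *: x) p = r * rpair x p.
Proof. by rewrite /rpair pairZl Re_realM. Qed.

Lemma rpairZr (r : R) x p : rpair x (r%:C%C *: p) = r * rpair x p.
Proof. by rewrite /rpair pairZr Re_realM. Qed.

Lemma rpair_le x p : rpair x p <= nm x * nm p.
Proof. exact: le_trans (Re_le_cabs _) (cabs_pair_le _ _). Qed.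

Lemma rpair_linear x : real_linear (rpair x).
Proof. by split=> [p q|r p]; [exact: rpairDr|exact: rpairZr]. Qed.

Lemma nm_le_rpair x (c : R) :
  0 <= c -> (forall p, rpair x p <= c * nm p) -> nm x <= c.
Proof.
move=> c0 h; rewrite -lec_nm.
apply: (pair_norm (jbw_axioms E) x _).2; first by rewrite lecR.
move=> p; have [om om1 omE] := rotation (pair x p).
have := h (om *: p); rewrite nmZ om1 mul1r /rpair pairZr omE /= => hp.
rewrite (nmE p) -rmorphM.
have -> : `|pair x p| = (complex.Re `|pair x p|)%:C%C by rewrite RRe_real // normr_real.
by rewrite lecR.
Qed.

Lemma rpair_inj x y : (forall p, rpair x p = rpair y p) -> x = y.
Proof.
move=> xy; apply/eqP; rewrite -subr_eq0 -nm_eq0 eq_le nm_ge0 andbT.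
apply: nm_le_rpair => // p.
by rewrite rpairDl rpairNl xy subrr mul0r.
Qed.

Lemma pair_eq0 x p : (forall k, rpair x (k *: p) <= 0) -> pair x p = 0.
Proof.
move=> h; have [om om1 omE] := rotation (pair x p).
have := h om; rewrite /rpair pairZr omE /= => h0.
apply/eqP; rewrite -(@normr_eq0 R[i]) -[`|_|]RRe_real ?normr_real //.
by rewrite eq_complex /= eqxx andbT eq_le h0 cabs_ge0.
Qed.

Lemma dual_point (f : P -> R) (c : R) : 0 <= c -> real_linear f ->
  (forall p, f p <= c * nm p) ->
  exists2 x, (forall p, rpair x p = f p) & nm x <= c.
Proof.
move=> c0 [fD fZ] fc.
(* The complex-linear functional with real part [f] is [f p - i f (i p)]. *)
pose phi p : R[i]^o := Complex (f p) (- f ('i *: p)).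
have scaleE (a b : R) p : Complex a b *: p = a%:C%C *: p + b%:C%C *: ('i *: p).
  rewrite scalerA -scalerDl; congr (_ *: _); apply/eqP.
  by rewrite eq_complex /= !(mul0r, mulr0, mulr1, subr0, addr0, add0r) !eqxx.
have fi p : f ('i *: ('i *: p)) = - f p.
  have -> : 'i *: ('i *: p) = (- 1)%:C%C *: p.
    by rewrite scalerA -expr2 sqrCi rmorphN rmorph1.
  by rewrite fZ mulN1r.
have phi_lin : linear phi.
  move=> [a b] p q.
  have ikpq : 'i *: (Complex a b *: p + q) = Complex a b *: ('i *: p) + 'i *: q.
    by rewrite scalerDr !scalerA mulrC.
  rewrite /phi ikpq !fD (scaleE a b p) (scaleE a b ('i *: p)) !fD !fZ fi.
  by apply/eqP; rewrite eq_complex /=; apply/andP; split; apply/eqP; ring.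
have f_le p : `|f p| <= c * nm p.
  rewrite ler_norml fc andbT -lerN2 opprK.
  have N1 : (- 1)%:C%C = - 1 :> R[i] by rewrite rmorphN rmorph1.
  by have := fc (- p); rewrite -{1}scaleN1r -N1 fZ mulN1r nmN.
have nmi p : nm ('i *: p) = nm p by rewrite nmZ normCi mul1r.
have phi_le p : nm (phi p) <= 2 * c * nm p.
  have := cabs_le_add (phi p); rewrite /= normrN.
  have := f_le p; have := f_le ('i *: p); rewrite nmi /nm /=; lra.
have phi_cont : continuous phi.
  move=> p; apply/cvgrPdist_lt => d d0.
  have dE : d = (complex.Re d)%:C%C by rewrite RRe_real // gtr0_real.
  have d'0 : 0 < complex.Re d by rewrite -ltcR -dE.
  have c21 : 0 < 2 * c + 1 by rewrite ltr_wpDl // mulr_ge0.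
  apply/nbhs_ballP; exists (complex.Re d / (2 * c + 1))%:C%C => /=.
    by rewrite ltcR divr_gt0.
  move=> q; rewrite -ball_normE /ball_ /= (nmE (p - q)) ltcR ltr_pdivlMr // => pq.
  have -> : phi p - phi q = phi (p - q).
    have h := phi_lin (- 1) q p; rewrite !scaleN1r in h.
    by rewrite [p - q]addrC h [RHS]addrC.
  rewrite (nmE (phi (p - q) : R[i]^o)) dE ltcR.
  apply: le_lt_trans (phi_le _) _; apply: le_lt_trans pq.
  by rewrite mulrC ler_wpM2l ?nm_ge0 ?lerDl.
have [x hx] := pair_surj (jbw_axioms E) phi_lin phi_cont.
have xE p : rpair x p = f p by rewrite /rpair hx.
by exists x => //; apply: nm_le_rpair => // p; rewrite xE.
Qed.

Lemma predual_norming p : exists2 x, nm x <= 1 & rpair x p = nm p.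
Proof.
have nm_sub : sublinear (@nm R P).
  by split=> [q q'|r q r0]; rewrite ?nmD // nmZr gtr0_norm.
have [f [fl fle fp _]] := extreme_minorant p nm_sub.
have [|x xE x1] := @dual_point f 1 ler01 fl.
  by move=> q; rewrite mul1r.
by exists x; rewrite ?xE.
Qed.

End duality.

(** * Normal functionals supported by a Peirce-2 space *)

Section nondegeneracy.
Variables (R : realType) (E : jbwTriple R).
Local Notation P := (predual E).
Local Notation pair := (@predual_pairing R E).
Implicit Types (x y z w e u : E) (p q : P) (k : R[i]).

Lemma predual_limit (p_ : nat -> P) (K : R) :
  (forall m n, nm (p_ m - p_ n) <= K * (m.+1%:R^-1 + n.+1%:R^-1)) ->
  exists p, forall d : R, 0 < d -> exists N, forall n, (N <= n)%N ->
    nm (p - p_ n) < d.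
Proof.
move=> hp.
have small (d : R) : 0 < d -> exists N, forall n, (N <= n)%N ->
    `|K| * (n.+1%:R^-1 + n.+1%:R^-1) < d.
  move=> d0; have [N hN] : exists N : nat, 2 * `|K| / d < N%:R.
    exists (Num.bound (2 * `|K| / d)); apply: archi_boundP.
    by rewrite !mulr_ge0 // invr_ge0 ltW.
  exists N => n Nn; have n0 : (0 : R) < n.+1%:R by rewrite ltr0n.
  have h : 2 * `|K| / d < n.+1%:R.
    by rewrite (lt_le_trans hN) // ler_nat (leq_trans Nn).
  rewrite ltr_pdivrMr // in h.
  have -> : `|K| * (n.+1%:R^-1 + n.+1%:R^-1) = 2 * `|K| / n.+1%:R by ring.
  by rewrite ltr_pdivrMr // (mulrC d).
have cauchy_p : cvg (p_ @ \oo).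
  apply/cauchy_cvgP/cauchy_ballP => d d0.
  have dE : d = (complex.Re d)%:C%C by rewrite RRe_real // gtr0_real.
  have d'0 : 0 < complex.Re d by rewrite -ltcR -dE.
  have [N hN] := small _ d'0.
  pose tail : set P := [set p_ n | n in [set n | (N <= n)%N]].
  exists (tail, tail) => /=; first by split; exists N => // n Nn; exists n.
  move=> [_ _] /= [[m Nm <-] [n Nn <-]].
  rewrite -ball_normE /ball_ /= nmE dE ltcR.
  apply: le_lt_trans (hp m n) _; apply: le_lt_trans (hN N (leqnn N)).
  apply: (@le_trans _ _ (`|K| * (m.+1%:R^-1 + n.+1%:R^-1))).
    by rewrite ler_wpM2r ?ler_norm // addr_ge0.
  by rewrite ler_wpM2l // lerD // lef_pV2 ?posrE ?ltr0n // ler_nat ltnS.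
exists (lim (p_ @ \oo)) => d d0.
have /cvgrPdist_lt /(_ d%:C%C) := cauchy_p; rewrite ltcR => /(_ d0)[N _ hN].
by exists N => n Nn; have := hN n Nn; rewrite /= nmE ltcR.
Qed.

(** For [z] in the kernel of [Q(e)], pairing [e + t z] with [p_ n] at [t = 1 / (n + 1)] gives [1 + t
    Re <z, p_ n> <= (1 + C t^2) (1 + t^2)] when [|z| <= 1], so [p_ n] is of order [t] there. The
    sequence is constant on the image of [Q(e)], which together with the kernel spans [E]; hence it
    is Cauchy in the predual. *)
Lemma predual_peirce2 e (p_ : nat -> P) : tripotent e -> e != 0 ->
  (forall n, nm (p_ n) <= 1 + n.+1%:R^-1 ^+ 2) ->
  (forall n, 1 <= rpair e (p_ n)) ->
  (forall n w, pair <|e, w, e|> (p_ n) = pair <|e, w, e|> (p_ 0%N)) ->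
  exists p, (forall w, pair <|e, w, e|> p = pair <|e, w, e|> (p_ 0%N)) /\
    (forall z, <|e, z, e|> = 0 -> pair z p = 0).
Proof.
move=> e3 e0 p_le p_e p_const.
have [C C0 hC] := nm_peirce_perturbation e3 e0.
have [K K0 hK] := tp_bounded E.
pose t n : R := n.+1%:R^-1.
have t0 n : 0 < t n by rewrite invr_gt0 ltr0n.
have t1 n : t n <= 1 by rewrite invf_le1 ?ler1n ?ltr0n.
have ker_small1 n z : <|e, z, e|> = 0 -> nm z <= 1 ->
    rpair z (p_ n) <= (1 + 2 * C) * t n.
  move=> ez z1; have tz : nm ((t n)%:C%C *: z) <= t n.
    by rewrite nmZr gtr0_norm // ger_pMr.
  have h1 : nm (e + (t n)%:C%C *: z) <= 1 + C * t n ^+ 2.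
    apply: le_trans (hC _ _ _) _.
    - by rewrite tpZm ez scaler0.
    - exact: le_trans tz (t1 n).
    - by rewrite lerD2l ler_pM2l // ler_sqr ?nnegrE ?nm_ge0 // ltW.
  have h2 := rpair_le (e + (t n)%:C%C *: z) (p_ n).
  rewrite rpairDl rpairZl in h2.
  have h3 : nm (e + (t n)%:C%C *: z) * nm (p_ n) <=
      (1 + C * t n ^+ 2) * (1 + t n ^+ 2).
    by apply: ler_pM; rewrite ?nm_ge0.
  have h4 := p_e n; have tn0 := t0 n; have tn1 := t1 n.
  have h5 : t n * rpair z (p_ n) <= t n * ((1 + 2 * C) * t n).
    have h6 : C * t n ^+ 4 <= C * t n ^+ 2.
      by rewrite ler_pM2l // ler_wiXn2l // ltW.
    have h7 : (1 + C * t n ^+ 2) * (1 + t n ^+ 2) =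
      1 + t n ^+ 2 + C * t n ^+ 2 + C * t n ^+ 4 by ring.
    have h8 : t n * ((1 + 2 * C) * t n) = t n ^+ 2 + 2 * (C * t n ^+ 2) by ring.
    lra.
  by rewrite ler_pM2l in h5.
have ker_small n z : <|e, z, e|> = 0 ->
    rpair z (p_ n) <= (1 + 2 * C) * t n * nm z.
  move=> ez; have [->|z0] := eqVneq z 0.
    by rewrite nm0 mulr0 /rpair pair0l.
  have zp : 0 < nm z by rewrite nm_gt0.
  have := ker_small1 n ((nm z)^-1%:C%C *: z).
  rewrite tpZm ez scaler0 nmZr gtr0_norm ?invr_gt0 // mulVf ?gt_eqF // rpairZl.
  by move=> /(_ erefl (lexx _)); rewrite ler_pdivrMl // mulrC.
have decomp z : exists w z0,
    [/\ z = <|e, w, e|> + z0, <|e, z0, e|> = 0 & nm z0 <= (1 + K ^+ 2) * nm z].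
  exists <|e, z, e|>, (z - <|e, <|e, z, e|>, e|>); split.
  - by rewrite addrC subrK.
  - by rewrite tpDm tpNm tripotent_QQQ // subrr.
  rewrite mulrDl mul1r; apply: (le_trans (nmB _ _)); rewrite lerD2l.
  apply: (le_trans (hK _ _ _)); rewrite (tripotent_nm e3 e0) !mulr1 expr2 -mulrA.
  by rewrite ler_pM2l //; have := hK e z e; rewrite (tripotent_nm e3 e0) !mulr1.
pose D := (1 + 2 * C) * (1 + K ^+ 2).
have C21 : 0 < 1 + 2 * C by rewrite addr_gt0 // mulr_gt0.
have [|p hp] := @predual_limit p_ D.
  move=> m n; have [z z1 <-] := predual_norming (p_ m - p_ n).
  have [w [z0 [zE ez0 z0_le]]] := decomp z.
  have ez0N : <|e, - z0, e|> = 0 by rewrite tpNm ez0 oppr0.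
  have rconst : rpair <|e, w, e|> (p_ m) = rpair <|e, w, e|> (p_ n).
    by rewrite /rpair !p_const.
  rewrite zE rpairDr rpairNr !rpairDl rconst opprD addrACA subrr add0r.
  have h1 := ker_small m z0 ez0; have h2 := ker_small n (- z0) ez0N.
  rewrite rpairNl nmN in h2.
  have h3 : nm z0 <= 1 + K ^+ 2.
    have K1 : 0 < 1 + K ^+ 2 by rewrite addr_gt0 // exprn_gt0.
    by apply: le_trans z0_le _; apply: ler_piMr; first exact: ltW.
  have h4 j : (1 + 2 * C) * t j * nm z0 <= D * t j.
    have -> : D * t j = (1 + 2 * C) * t j * (1 + K ^+ 2) by rewrite /D; ring.
    by rewrite ler_pM2l // mulr_gt0.
  rewrite mulrDr -/(t m) -/(t n); have := h4 m; have := h4 n; lra.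
have limit z (b : R) : 0 <= b -> (forall n, complex.Re `|pair z (p_ n)| <= b) ->
    complex.Re `|pair z p| <= b.
  move=> b0 hb; apply/ler_addgt0Pr => d d0.
  have z1 : 0 < nm z + 1 by rewrite ltr_wpDl ?nm_ge0.
  have [N hN] := hp _ (divr_gt0 d0 z1).
  have -> : pair z p = pair z (p_ N) + pair z (p - p_ N).
    by rewrite -pairDr addrC subrK.
  apply: (le_trans (@nmD R R[i]^o _ _)); rewrite lerD ?hb //.
  apply: (le_trans (cabs_pair_le _ _)).
  have := hN N (leqnn N); rewrite ltr_pdivlMr // => h.
  have := nm_ge0 (p - p_ N); have := nm_ge0 z; nra.
have cabs0 k : complex.Re `|k| <= 0 -> k = 0.
  move=> k0; apply/eqP; rewrite -(@nm_eq0 R R[i]^o) eq_le k0 /=.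
  exact: cabs_ge0.
exists p; split=> [w|z ez].
  have [N hN] := hp 1 ltr01.
  apply/eqP; rewrite -subr_eq0; apply/eqP/cabs0/ler_addgt0Pr => d d0.
  rewrite add0r -pairNr -pairDr.
  have z1 : 0 < nm <|e, w, e|> + 1 by rewrite ltr_wpDl ?nm_ge0.
  have [M hM] := hp _ (divr_gt0 d0 z1).
  rewrite pairDr pairNr -(p_const M) -pairNr -pairDr.
  apply: (le_trans (cabs_pair_le _ _)).
  have := hM M (leqnn M); rewrite ltr_pdivlMr // => h.
  have := nm_ge0 (p - p_ M); nra.
apply: pair_eq0 => k; rewrite /rpair pairZr -pairZl -/(rpair _ p).
have ekz : <|e, k *: z, e|> = 0 by rewrite tpZm ez scaler0.
move: (k *: z) ekz => {ez k}z ez.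
apply/ler_addgt0Pr => d d0; rewrite add0r.
pose B := nm z + (1 + 2 * C) * nm z + 1.
have B0 : 0 < B.
  by rewrite /B ltr_wpDl // addr_ge0 ?nm_ge0 // mulr_ge0 ?nm_ge0 // ltW.
have [N hN] := hp _ (divr_gt0 d0 B0).
have [M hM] : exists M : nat, B / d < M%:R.
  by exists (Num.bound (B / d)); apply/archi_boundP/ltW; rewrite divr_gt0.
pose n := maxn N M.
have hn : nm (p - p_ n) < d / B by apply: hN; exact: leq_maxl.
have tn : t n < d / B.
  rewrite /t -[d / B]invrK ltf_pV2 ?posrE ?ltr0n ?invr_gt0 ?divr_gt0 //.
  by rewrite invf_div (lt_le_trans hM) // ler_nat ltnW // ltnS leq_maxr.
have -> : p = p_ n + (p - p_ n) by rewrite addrC subrK.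
rewrite rpairDr; have h1 := ker_small n z ez; have h2 := rpair_le z (p - p_ n).
have h3 : nm z * nm (p - p_ n) <= nm z * (d / B).
  by rewrite ler_wpM2l ?nm_ge0 // ltW.
have h4 : (1 + 2 * C) * t n * nm z <= (1 + 2 * C) * nm z * (d / B).
  by rewrite mulrAC ler_wpM2l ?(ltW tn) // mulr_ge0 ?nm_ge0 // ltW.
have h5 : nm z * (d / B) + (1 + 2 * C) * nm z * (d / B) + d / B = d.
  have -> : nm z * (d / B) + (1 + 2 * C) * nm z * (d / B) + d / B = B * (d / B).
    by rewrite /B; ring.
  by rewrite mulrC divfK // gt_eqF.
have h6 : 0 < d / B by rewrite divr_gt0.
lra.
Qed.

(** The image of [Q(u)] is the line of [u], so normalizing the almost norming functionals to the
    value 1 at [u] makes them agree on it. *)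
Lemma minimal_predual u : minimal_tripotent u ->
  exists p, forall y k, <|u, y, u|> = k *: u -> pair y p = Num.conj k.
Proof.
move=> u_min; have u0 := minimal_neq0 u_min; have [u3 _ _] := u_min.
have exists_p n : exists p, nm p <= 1 + n.+1%:R^-1 ^+ 2 /\ pair u p = 1.
  set c : R := 1 + n.+1%:R^-1 ^+ 2.
  have c1 : 1 < c by rewrite ltrDl exprn_gt0 // invr_gt0 ltr0n.
  have c0 : 0 < c by rewrite (lt_trans ltr01).
  have [p hp] : exists p, c^-1 * nm p < rpair u p.
    apply: contrapT => /forallNP h.
    have : nm u <= c^-1.
      apply: nm_le_rpair => [|p]; first by rewrite invr_ge0 ltW.
      by rewrite leNgt; apply/negP; exact: h.
    by rewrite tripotent_nm // leNgt invf_lt1 // c1.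
  have up : complex.Re `|pair u p| > c^-1 * nm p.
    exact: lt_le_trans hp (Re_le_cabs _).
  have up0 : 0 < complex.Re `|pair u p|.
    by rewrite (le_lt_trans _ up) // mulr_ge0 ?nm_ge0 // invr_ge0 ltW.
  have pn0 : pair u p != 0.
    by apply/eqP => h; move: up0; rewrite h normr0 ltxx.
  exists ((pair u p)^-1 *: p); split; last by rewrite pairZr mulVf.
  rewrite nmZ; have -> : complex.Re `|(pair u p)^-1| = (complex.Re `|pair u p|)^-1.
    apply: (@mulIf _ (complex.Re `|pair u p|)); first by rewrite gt_eqF.
    by rewrite -cabsM mulVf // mulVf ?gt_eqF // normr1.
  by rewrite ler_pdivrMl // mulrC -ler_pdivrMl // ltW.
have [p_ hp_] := boolp.choice exists_p.
have [|n|n w|p [pQ p0]] := @predual_peirce2 u p_ u3 u0.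
- by move=> n; have [] := hp_ n.
- by rewrite /rpair; have [_ ->] := hp_ n.
- have [k ->] := minimal_rank_one u_min w.
  by rewrite !pairZl; have [_ ->] := hp_ n; have [_ ->] := hp_ 0%N.
exists p => y k yk.
have -> : y = <|u, <|u, y, u|>, u|> + (y - <|u, <|u, y, u|>, u|>).
  by rewrite addrC subrK.
rewrite pairDl (p0 (y - _)) ?addr0; last by rewrite tpDm tpNm tripotent_QQQ // subrr.
by rewrite pQ yk tpZm u3 pairZl; have [_ ->] := hp_ 0%N; rewrite mulr1.
Qed.

(** Being nonzero at [p] is a weak-star open condition, so by density it would hold at some element
    of the span. *)
Lemma atomic_pair_eq0 : atomic E -> forall p,
  (forall u, minimal_tripotent u -> pair u p = 0) -> forall x, pair x p = 0.
Proof.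
move=> E_atomic p up x; apply: contrapT => xp.
pose O : set (weak_star E) := [set y | pair y p != 0].
have O_open : open O.
  rewrite (_ : O =
    (fun y : weak_star E => pair y p : R[i]^o) @^-1` [set k | k != 0]) //.
  apply: open_comp; last first.
    rewrite (_ : [set k | k != 0] = ~` [set (0 : R[i]^o)]).
      rewrite openC; apply/accessible_closed_set1/hausdorff_accessible.
      exact: norm_hausdorff.
    by apply/seteqP; split=> k /= /eqP.
  move=> y _; apply: (@continuous_comp _ _ _
    (pair : weak_star E -> {ptws P -> R[i]^o}) (fun f : {ptws P -> R[i]^o} => f p)).
    exact: initial_continuous.
  exact: proj_continuous.
have [|y [/= yp [n [a [v [hv yE]]]]]] := E_atomic O _ O_open.
  by exists x; apply/eqP.
move/eqP : yp; apply; rewrite yE.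
elim/big_ind: _ => [|y1 y2 h1 h2|i _]; first exact: pair0l.
  by rewrite pairDl h1 h2 addr0.
by rewrite pairZl up ?mulr0.
Qed.

End nondegeneracy.

(** * Truncation preservers *)

Section atomic_nondegenerate.
Variables (R : realType) (E : jbwTriple R).
Local Notation P := (predual E).
Local Notation pair := (@predual_pairing R E).
Implicit Types (x y z w e u : E) (p q : P) (k : R[i]).

Lemma annihilatedD x y : annihilated x -> annihilated y -> annihilated (x + y).
Proof. by move=> hx hy u hu; rewrite tpDm hx // hy // addr0. Qed.

Lemma annihilatedZ k x : annihilated x -> annihilated (k *: x).
Proof. by move=> hx u hu; rewrite tpZm hx // scaler0. Qed.

Lemma annihilated_Q x w : annihilated x -> annihilated <|x, w, x|>.
Proof.
move=> hx u hu; have [u3 _ _] := hu; have ux := annihilated_peirce0 hx hu.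
by apply: peirce0_Q => //; rewrite tp_jordanE ux !tp0 peirce0_QL // oppr0 !addr0.
Qed.

(** As [L(u,u) x = 0], [L(u,u)] commutes with [L(x,x)]; so [L(x,x) + 1], which is injective, sends
    [L(u,u) a] to 0. *)
Lemma annihilated_cayley x a :
  annihilated x -> <|x, x, a|> + a = 2%:R *: x -> annihilated a.
Proof.
move=> hx xa u hu; have [u3 _ _] := hu; have ux := annihilated_peirce0 hx hu.
apply: peirce0_Q => //; apply: (@add_box_inj _ _ x).
have := congr1 (fun z => <|u, u, z|>) xa; rewrite tpDr tpZr ux scaler0.
by rewrite tp_jordanE ux !tp0 subrr add0r.
Qed.

(* [rho] is the norm of the quotient of the predual by the annihilator [Qp] of
   the set [N] of the annihilated elements; its extreme minorants are the
   extreme points of the unit ball of [N]. *)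
Lemma annihilated_eq0 : atomic E -> forall x, annihilated x -> x = 0.
Proof.
move=> E_atomic x xN; apply: contrapT => /eqP x0.
pose Qp p := forall y, annihilated y -> pair y p = 0.
have Qp0 : Qp 0 by move=> y _; exact: pair0r.
have QpD p q : Qp p -> Qp q -> Qp (p + q).
  by move=> hp hq y hy; rewrite pairDr hp // hq // addr0.
have QpZ k p : Qp p -> Qp (k *: p).
  by move=> hp y hy; rewrite pairZr hp // mulr0.
pose rho p : R := inf [set nm (p + q) | q in Qp].
have rho_lb p q : Qp q -> rho p <= nm (p + q).
  move=> hq; apply: inf_lbound; last by exists q.
  by exists 0 => _ [q' _ <-]; exact: nm_ge0.
have le_rho p r : (forall q, Qp q -> r <= nm (p + q)) -> r <= rho p.
  move=> h; apply: lb_le_inf; last by move=> _ [q hq <-]; exact: h.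
  by exists (nm (p + 0)); exists 0.
have rho_sub : sublinear rho.
  split=> [p p'|r p r0].
    rewrite -lerBlDr; apply: (le_rho) => q hq.
    rewrite lerBlDr -lerBlDl; apply: (le_rho) => q' hq'.
    rewrite lerBlDl (le_trans (rho_lb _ _ (QpD _ _ hq hq'))) //.
    by rewrite addrACA nmD.
  rewrite -ler_pdivrMl //; apply: (le_rho) => q hq; rewrite ler_pdivrMl //.
  rewrite (le_trans (rho_lb _ _ (QpZ r%:C%C _ hq))) //.
  by rewrite -scalerDr nmZr gtr0_norm.
have rho_nm p : rho p <= 1 * nm p by have := rho_lb p 0 Qp0; rewrite addr0 mul1r.
have rpair_rho y : annihilated y -> nm y <= 1 -> forall p, rpair y p <= rho p.
  move=> yN y1 p; apply: (le_rho) => q hq.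
  have -> : rpair y p = rpair y (p + q) by rewrite /rpair pairDr hq ?addr0.
  by rewrite (le_trans (rpair_le _ _)) // ler_piMl ?nm_ge0.
have [p1 rho1] : exists p1, 0 < rho p1.
  apply: contrapT => /forallNP h; move/negP : x0; apply.
  rewrite -nm_eq0 eq_le nm_ge0 andbT; apply: nm_le_rpair => // p.
  rewrite mul0r leNgt; apply/negP => xp; apply: (h p).
  have xp0 : 0 < nm x + 1 by rewrite ltr_wpDl ?nm_ge0.
  apply: (@lt_le_trans _ _ (rpair ((nm x + 1)^-1%:C%C *: x) p)).
    by rewrite rpairZl mulr_gt0 // invr_gt0.
  apply: rpair_rho; first exact: annihilatedZ.
  rewrite nmZr gtr0_norm ?invr_gt0 // ler_pdivrMl // mulr1.
  by rewrite lerDl.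
pose p0 := (rho p1)^-1%:C%C *: p1.
have rho0 : rho p0 = 1.
  by rewrite sublinearZ ?invr_ge0 ?(ltW rho1) // mulVf // gt_eqF.
have [f [fl f_rho fp0 f_ext]] := extreme_minorant p0 rho_sub.
have [y yE y1] : exists2 y, (forall p, rpair y p = f p) & nm y <= 1.
  by apply: dual_point => // p; exact: le_trans (f_rho p) (rho_nm p).
(* [rho] vanishes on [Qp], hence so does [y]; and [Qp] contains the functionals of the minimal
   tripotents. *)
have yN : annihilated y.
  move=> u hu; have [k uk] := minimal_rank_one hu y.
  have [q hq] := minimal_predual hu.
  have Qq : Qp q by move=> z zN; rewrite (hq z 0) ?rmorph0 // zN // scale0r.
  have : pair y q = 0.
    apply: pair_eq0 => l; rewrite yE (le_trans (f_rho _)) //.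
    have := rho_lb (l *: q) (- l *: q) (QpZ _ _ Qq).
    by rewrite scaleNr subrr nm0.
  by rewrite (hq _ _ uk) uk => /eqP; rewrite fmorph_eq0 => /eqP ->; rewrite scale0r.
have y3 : tripotent y.
  have [a [ya a1 b1]] := ball_midpoint y1.
  have aN : annihilated a := annihilated_cayley yN ya.
  have bN : annihilated <|y, y, a|>.
    have -> : <|y, y, a|> = 2%:R *: y + (- 1) *: a by rewrite -ya; lmod_in R[i] E.
    by apply: annihilatedD; exact: annihilatedZ.
  have ay : a = y.
    apply: rpair_inj => p; rewrite yE.
    apply: (f_ext (rpair a) (rpair <|y, y, a|>)).
    - exact: rpair_linear.
    - exact: rpair_linear.
    - exact: rpair_rho.
    - exact: rpair_rho.
    move=> q; rewrite -rpairDl addrC ya -yE /rpair pairZl.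
    by rewrite -(rmorph_nat (real_complex R)) Re_realM.
  move: ya; rewrite ay /tripotent => ya.
  by apply: (@eq_lincomb1 _ _ 1 _ _ _ _ ya); lmod_in R[i] E.
have y0 : y != 0.
  apply/eqP => y0; have := yE p0; rewrite fp0 rho0 y0 /rpair pair0l => /eqP.
  by rewrite eq_sym oner_eq0.
(* Representatives of the class of [p0] with norms tending to 1. They agree on [N], hence on the
   image of [Q(y)]. *)
have exists_q n : exists q, Qp q /\ nm (p0 + q) <= 1 + n.+1%:R^-1 ^+ 2.
  have d0 : 0 < n.+1%:R^-1 ^+ 2 :> R by rewrite exprn_gt0 // invr_gt0 ltr0n.
  have [|r [q hq <-]] := @inf_adherent _ [set nm (p0 + q) | q in Qp] _ d0.
    split; first by exists (nm (p0 + 0)); exists 0.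
    by exists 0 => _ [q' _ <-]; exact: nm_ge0.
  by rewrite -/(rho p0) rho0 => /ltW h; exists q.
have [q_ hq_] := boolp.choice exists_q.
have pair_pq z n : annihilated z -> pair z (p0 + q_ n) = pair z p0.
  by move=> zN; rewrite pairDr; have [-> //] := hq_ n; rewrite addr0.
have [|n|n w|p [pQ pker]] := @predual_peirce2 _ _ y (fun n => p0 + q_ n) y3 y0.
- by move=> n; have [] := hq_ n.
- by rewrite /rpair pair_pq // -/(rpair y p0) yE fp0 rho0.
- by rewrite !pair_pq //; exact: annihilated_Q.
(* [L(u,u) y = 0] gives [Q(y) u = 0], so each minimal tripotent [u] lies in the kernel on which [p]
   vanishes. *)
have yp0 : pair y p = 0.
  apply: atomic_pair_eq0 => // u hu; apply: pker; have [u3 _ _] := hu.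
  have := peirce0_QL u3 u (annihilated_peirce0 yN hu).
  by rewrite u3.
have := pQ y; rewrite y3 yp0 pair_pq // => /(congr1 (@complex.Re R)).
rewrite -/(rpair y p0) yE fp0 rho0 /= => /eqP.
by rewrite eq_sym oner_eq0.
Qed.

End atomic_nondegenerate.

(** * Preservers, with [s] standing for the identity or the conjugation *)

Section truncation_preservers.
Variables (R : realType) (E F : jbwTriple R) (D : E -> F) (s : R[i] -> R[i]).
Hypotheses (D_bij : bijective D) (D_trunc : preserves_truncation D).
Hypotheses (sD : {morph s : a b / a + b}) (sM : {morph s : a b / a * b}).
Hypotheses (sK : involutive s) (s_conj : forall a, s (Num.conj a) = Num.conj (s a)).
Hypothesis D_scale : forall e a, minimal_tripotent e -> D (a *: e) = s a *: D e.
Hypothesis E_atomic : atomic E.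
Implicit Types (x y z e b c : E) (a k l : R[i]).

Let s0 : s 0 = 0.
Proof. by apply: (@addrI _ (s 0)); rewrite -sD !addr0. Qed.

Let s_eq0 a : (s a == 0) = (a == 0).
Proof. by rewrite -{1}s0 (inj_eq (can_inj sK)). Qed.

(** With [b] the preimage of 0, 0 is a truncation of [{b, 0, b}]; so [D 0] is a truncation of
    [{0, D 0, 0} = 0] and its cube vanishes. *)
Lemma preserver0 : D 0 = 0.
Proof.
have [D' DK KD] := D_bij; apply: tp_cube_eq0.
have : truncation 0 <|D' 0, 0, D' 0|> by rewrite /truncation !tp0.
by move/D_trunc; rewrite KD tp0 /truncation tp0.
Qed.

Lemma preserver_neq0 x : x != 0 -> D x != 0.
Proof. by apply: contra => /eqP; rewrite -preserver0 => /(bij_inj D_bij) ->. Qed.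

Lemma preserver_tripotent x : tripotent x -> tripotent (D x).
Proof.
by move=> /tripotent_trunc/D_trunc/tripotent_trunc.
Qed.

Lemma truncation_minimal (G : jbTriple R) (e y : G) a l : tripotent e -> e != 0 ->
  <|e, y, e|> = l *: e -> truncation (a *: e) y <-> a = 0 \/ Num.conj a = l.
Proof.
move=> e3 e0 yl.
have E1 : <|a *: e, a *: e, a *: e|> = (a * Num.conj a * a) *: e.
  by rewrite tpZl tpZm tpZr e3 !scalerA.
have E2 : <|a *: e, y, a *: e|> = (a * a * l) *: e.
  by rewrite tpZl tpZr yl !scalerA.
rewrite /truncation E1 E2; split=> [/eqP|]; last first.
  by case=> [->|<-]; [rewrite !(mul0r, scale0r)|congr (_ *: _); ring].
rewrite -subr_eq0 -scalerBl scaler_eq0 (negPf e0) orbF.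
have -> : a * Num.conj a * a - a * a * l = a ^+ 2 * (Num.conj a - l) by ring.
rewrite mulf_eq0 expf_eq0 /= subr_eq0 => /orP[] /eqP ->; first by left.
by right.
Qed.

Lemma preserver_minimal e : minimal_tripotent e -> minimal_tripotent (D e).
Proof.
move=> he; have e0 := minimal_neq0 he; have [e3 _ _] := he.
have De3 := preserver_tripotent e3; have De0 := preserver_neq0 e0.
have [D' DK KD] := D_bij.
apply: rank_one_minimal => // d.
have [l el] := minimal_rank_one he (D' d).
(* If [l = 0], the product [y = {D e, d, D e}], a truncation of itself, has as preimage a truncation
   of 0. Otherwise [l *: e] is a truncation of [{e, D' d, e}], and its image determines [y]. *)
have [l0|l0] := eqVneq l 0.
  exists 0; rewrite scale0r; apply: contrapT => y0.
  pose y := <|D e, d, D e|>.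
  have : truncation (D (D' y)) <|D e, D (D' d), D e|> by rewrite !KD.
  move/D_trunc; rewrite el l0 scale0r /truncation tp0 => /tp_cube_eq0 Dy0.
  by apply: y0; rewrite -/y -(KD y) Dy0 preserver0.
have eel : <|e, <|e, D' d, e|>, e|> = Num.conj l *: e by rewrite el tpZm e3.
have : truncation (l *: e) <|e, D' d, e|>.
  by apply/(truncation_minimal l e3 e0 eel); right.
move/D_trunc; rewrite KD D_scale // /truncation => h.
exists (s l); have sl0 : s l != 0 by rewrite s_eq0.
move: h; rewrite !(tpZl, tpZm, tpZr) De3 !scalerA.
move=> /(congr1 (fun z : F => (s l ^+ 2)^-1 *: z)); rewrite !scalerA.
have -> : (s l ^+ 2)^-1 * (s l * s l) = 1 by field.
have -> : (s l ^+ 2)^-1 * (s l * Num.conj (s l) * s l) = Num.conj (s l) by field.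
rewrite scale1r => h.
have yy : <|D e, D e, <|D e, d, D e|>|> = <|D e, d, D e|> by exact: tripotent_LQ.
by rewrite -(peirce2_QQ De3 yy) -h tpZm conjCK De3.
Qed.

(** The scalars [a] for which [a *: e] is a truncation of the product are 0 and the conjugate of
    [l]; [s] carries them onto the corresponding set for the image product. *)
Lemma preserver_coef_trunc e b c l : minimal_tripotent e ->
  <|e, <|b, c, b|>, e|> = l *: e ->
  <|D e, <|D b, D c, D b|>, D e|> = s l *: D e.
Proof.
move=> he el; have hDe := preserver_minimal he.
have e0 := minimal_neq0 he; have [e3 _ _] := he.
have De0 := minimal_neq0 hDe; have [De3 _ _] := hDe.
have [l' Del] := minimal_rank_one hDe <|D b, D c, D b|>.
have key a : a = 0 \/ Num.conj a = l <-> s a = 0 \/ Num.conj (s a) = l'.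
  apply: iff_trans (iff_sym (truncation_minimal a e3 e0 el)) _.
  apply: iff_trans (D_trunc _ _ _) _; rewrite D_scale //.
  exact: truncation_minimal.
rewrite Del; congr (_ *: _).
have [l0|l0] := eqVneq l 0; last first.
  have [h|<-] := (key (Num.conj l)).1 (or_intror (conjCK l)).
    by move/eqP: h; rewrite s_eq0 fmorph_eq0 (negPf l0).
  by rewrite -s_conj conjCK.
rewrite l0 s0; apply: contrapT => /eqP l'0.
(* If [l = 0] but [l'] is nonzero, this scalar is admissible on the image side, [s] being an
   involution, but not on the side of [E]. *)
have [|h|h] := (key (s (Num.conj l'))).2.
- by right; rewrite sK conjCK.
- by move/eqP: h; rewrite s_eq0 fmorph_eq0 (negPf l'0).
- by move/eqP: h; rewrite l0 fmorph_eq0 s_eq0 fmorph_eq0 (negPf l'0).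
Qed.

Lemma preserver_coef e c l : minimal_tripotent e ->
  <|e, c, e|> = l *: e -> <|D e, D c, D e|> = s l *: D e.
Proof.
move=> he el; have [e3 _ _] := he.
have eel : <|e, <|e, c, e|>, e|> = Num.conj l *: e by rewrite el tpZm e3.
have := preserver_coef_trunc he eel; rewrite s_conj => h.
have De3 := preserver_tripotent e3.
by rewrite -(tripotent_QQQ De3) h tpZm conjCK De3.
Qed.

(** Additivity of [D] is still to be proved, so the difference is formed in [F] and pulled back as
    one element; that preimage is annihilated. *)
Lemma preserver_ext (z z' : F) : (forall e, minimal_tripotent e ->
  <|D e, z, D e|> = <|D e, z', D e|>) -> z = z'.
Proof.
move=> h; have [D' DK KD] := D_bij.
apply/eqP; rewrite -subr_eq0 -(KD (z - z')).
suff -> : D' (z - z') = 0 by rewrite preserver0.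
apply: (annihilated_eq0 E_atomic) => e he.
have [l el] := minimal_rank_one he (D' (z - z')).
have := preserver_coef he el; rewrite KD tpDm tpNm h // subrr => /esym/eqP.
rewrite scaler_eq0 (negPf (preserver_neq0 (minimal_neq0 he))) orbF s_eq0.
by move=> /eqP l0; rewrite el l0 scale0r.
Qed.

Lemma preserver_semilinear a x y : D (a *: x + y) = s a *: D x + D y.
Proof.
apply: preserver_ext => e he.
have [k ek] := minimal_rank_one he x; have [l el] := minimal_rank_one he y.
rewrite tpDm tpZm (preserver_coef he ek) (preserver_coef he el) -s_conj.
rewrite scalerA -scalerDl -sM -sD; apply: preserver_coef => //.
by rewrite tpDm tpZm ek el scalerA scalerDl.
Qed.

Let DD x y : D (x + y) = D x + D y.
Proof.
have s1 : s 1 = 1.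
  have h : s 1 * s 1 = s 1 by rewrite -sM mulr1.
  apply: (@mulfI _ (s 1)); first by rewrite s_eq0 oner_eq0.
  by rewrite h mulr1.
by have := preserver_semilinear 1 x y; rewrite s1 !scale1r.
Qed.

Lemma preserver_triple x y z : D <|x, y, z|> = <|D x, D y, D z|>.
Proof.
have DQ b c : D <|b, c, b|> = <|D b, D c, D b|>.
  apply: preserver_ext => e he.
  have [l el] := minimal_rank_one he <|b, c, b|>.
  by rewrite (preserver_coef he el) (preserver_coef_trunc he el).
have := DQ (x + z) y; rewrite !(tpDl, tpDr) !DD !(tpDl, tpDr) !DQ.
rewrite (tpC z y x) (tpC (D z) (D y) (D x)) => h.
by apply: (@eq_lincomb1 _ _ (2%:R^-1) _ _ _ _ h); lmod_in R[i] F.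
Qed.

End truncation_preservers.

Theorem theorem3p17 (R : realType) (E F : jbwTriple R) (Delta : E -> F)
    (E_atomic : atomic E) (F_atomic : atomic F)
    (Delta_bij : bijective Delta)
    (Delta_trunc : preserves_truncation Delta) :
  ((forall (e : E) (alpha : R[i]), minimal_tripotent e ->
      Delta (alpha *: e) = alpha *: Delta e) ->
   forall T : E -> F, triple_isomorphism T ->
     (forall e : E, minimal_tripotent e -> T e = Delta e) ->
     Delta = T /\ triple_isomorphism Delta)
  /\
  ((forall (e : E) (alpha : R[i]), minimal_tripotent e ->
      Delta (alpha *: e) = Num.conj alpha *: Delta e) ->
   conj_triple_isomorphism Delta).
Proof.
split=> [Delta_scale T T_iso T_Delta|Delta_scale].
  suff DT : Delta = T by rewrite DT.
  have [T_lin _ T_triple] := T_iso.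
  have T0 : T 0 = 0.
    by have := T_lin (- 1) 0 0; rewrite !scaleN1r oppr0 addr0 addNr.
  have TZ k x : T (k *: x) = k *: T x.
    by have := T_lin k x 0; rewrite T0 !addr0.
  have D_scale (e : E) a : minimal_tripotent e -> Delta (a *: e) = id a *: Delta e.
    exact: Delta_scale.
  apply/funext => x.
  (* At each minimal tripotent both [Delta x] and [T x] have the scalar of [x]. *)
  apply: (@preserver_ext _ _ _ _ id Delta_bij Delta_trunc _ _ _ D_scale E_atomic)
    => // e he.
  have [l el] := minimal_rank_one he x.
  rewrite (@preserver_coef _ _ _ _ id Delta_bij Delta_trunc _ _ _ D_scale _ _ _ he el)
    //.
  by rewrite -T_Delta // -T_triple el TZ.
have DE := Delta_scale.
split=> //.
  move=> a x y.
  exact: (preserver_semilinear Delta_bij Delta_trunc (rmorphD Num.conj)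
    (rmorphM Num.conj) (@conjCK _) (fun _ => erefl) DE E_atomic).
exact: (preserver_triple Delta_bij Delta_trunc (rmorphD Num.conj) (rmorphM Num.conj)
  (@conjCK _) (fun _ => erefl) DE E_atomic).
Qed.
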